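(* Assume that $\nu=0$, that is, consider the Cauchy problem $$\partial_t u+\nabla\cdot(u\,\nabla K*u)=0,\qquad u(x,0)=u_0(x),\qquad x\in\mathbb{R}^d,\ t\ge 0,$$ where $K(x)=k(|x|)$ for $x\in\mathbb{R}^d$ with $k$ a locally Lipschitz continuous function. Consider a nonnegative and integrable initial condition $u_0\not\equiv 0$ which is even, $u_0(x)=u_0(-x)$ for $x\in\mathbb{R}^d$, and satisfies $M_1:=\int_{\mathbb{R}^d}|x|\,u_0(x)\,dx<\infty$. (a) If $k$ fulfills (H1), or $k$ fulfills (H2) with $K_2=0$, then the solution $u$ to the Cauchy problem ceases to exist in a finite time. (b) If $k$ fulfills (H2) and $M_1$ is sufficiently small, then the solution $u$ to the Cauchy problem ceases to exist in a finite time.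
   Context: Conditions on $k$: (H1): there is $K_0>0$ such that $-K_0\le k'\le 0$ and $\kappa_R:=-\sup_{(0,R)}k'>0$ for each $R>0$. (H2): $k'(r)=-k_1'(r)+k_2'(r)$ for $r>0$, for some functions $k_1,k_2$, and there are $K_0>0$, $K_1>0$, $K_2\ge 0$ and $\delta\in[0,1)$ such that for all $r>0$ $$|k'(r)|\le K_0(1+r^\delta),\qquad K_1\le k_1'(r),\qquad k_2'(r)\le K_2\,r^\delta .$$ Solutions are understood to be nonnegative regular solutions which are even in $x$ (as implied by evenness of $u_0$, radial symmetry of $K$ and uniqueness) and conserve the total mass: $\int_{\mathbb{R}^d}u(x,t)\,dx=M:=\int_{\mathbb{R}^d}u_0(x)\,dx$. Local existence, positivity and mass conservation are taken for granted.
   Formalization: In (b), K_2<K_1 is added when δ=0: otherwise k=0 satisfies (H2) and every datum is a stationary global solution. Regular solutions are read as classical, with flux u∇K*u in L^1 locally boundedly in time. *)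

(* Defs.v *)
From HB Require Import structures.
From mathcomp Require Import all_boot all_order all_algebra.
From mathcomp Require Import all_classical all_reals all_analysis.

Set Implicit Arguments.
Unset Strict Implicit.
Unset Printing Implicit Defensive.

Import Order.TTheory GRing.Theory Num.Theory numFieldNormedType.Exports.
Local Open Scope classical_set_scope.
Local Open Scope ring_scope.

Section lebesgue_Rd.
Context {R : realType}.
Local Notation mR := (measurableTypeR R).

Definition tuple_cons n (p : n.-tuple mR * mR) : n.+1.-tuple mR :=
  [tuple of p.2 :: p.1].

Lemma measurable_tuple_cons n : measurable_fun setT (@tuple_cons n).
Proof. exact: measurable_cons. Qed.

(* Lebesgue measure on R^n, by iterated products transported along tuple_cons;
   the long name in the successor case is the library's measure structure on
   [pushforward], applied to the measurability proof. *)
Fixpoint lebesgue_tuple (n : nat) : {measure set (n.-tuple mR) -> \bar R} :=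
  if n is m.+1 then
    measure_function_pushforward__canonical__measure_function_Measure
      [the {measure set (m.-tuple mR * mR) -> \bar R} of
        (lebesgue_tuple m \x lebesgue_measure)%E]
      (measurable_tuple_cons (n := m))
  else [the {measure set (0.-tuple mR) -> \bar R} of dirac [tuple]].

Lemma measurable_box n (A : 'I_n -> set mR) :
  (forall i, measurable (A i)) ->
  measurable [set t : n.-tuple mR | forall i, A i (tnth t i)].
Proof.
move=> mA.
have -> : [set t : n.-tuple mR | forall i, A i (tnth t i)] =
    \big[setI/setT]_(i < n) ((fun t : n.-tuple mR => tnth t i) @^-1` A i).
  rewrite -bigcap_seq; apply/seteqP; split => t /= At i; first by move=> _; apply: At.
  by apply: (At i); rewrite /= mem_index_enum.
apply: bigsetI_measurable => i _.
by rewrite -[X in measurable X]setTI;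
  exact: (measurable_tnth i measurableT (mA i)).
Qed.

Lemma lebesgue_tuple_box n (A : 'I_n -> set mR) :
  (forall i, measurable (A i)) ->
  lebesgue_tuple n [set t | forall i, A i (tnth t i)] =
  (\prod_(i < n) lebesgue_measure (A i))%E.
Proof.
elim: n A => [|n IH] A mA.
  by rewrite big_ord0 /= diracE mem_set//= => -[].
rewrite big_ord_recl muleC /= /pushforward.
pose B := [set t : n.-tuple mR | forall i, A (lift ord0 i) (tnth t i)].
have -> : @tuple_cons n @^-1` [set t | forall i, A i (tnth t i)] = B `*` A ord0.
  apply/seteqP; split => -[t x] /=.
    move=> At; split => [i /=|]; last by have := At ord0; rewrite tnth0.
    by have := At (lift ord0 i); rewrite tnthS.
  move=> [Bt Ax] i; have [j ->|->] := unliftP ord0 i; last by rewrite tnth0.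
  by rewrite tnthS; exact: Bt.
have mB : measurable B.
  by apply: (@measurable_box n (fun i => A (lift ord0 i))) => i; exact: mA.
by rewrite product_measure1E// (IH (fun i => A (lift ord0 i))).
Qed.

End lebesgue_Rd.

Section aggregation.
Context {R : realType}.

Section space.
Variable d : nat.
Implicit Types (x : 'rV[R]_d) (f w : 'rV[R]_d -> R).

Definition point (t : d.-tuple (measurableTypeR R)) : 'rV[R]_d :=
  \row_i tnth t i.

Definition integrableRd f :=
  (lebesgue_tuple d).-integrable setT (fun t => (f (point t))%:E).

Definition integralRd f : \bar R :=
  (\int[lebesgue_tuple d]_t (f (point t))%:E)%E.

Definition negligibly_zero f := {ae lebesgue_tuple d, forall t, f (point t) = 0}.

(* [`|x|] on row vectors is the maximum norm in the library. *)
Definition eucl x : R := Num.sqrt (\sum_i x ord0 i ^+ 2).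

Definition partial (j : 'I_d) f x : R := 'D_(delta_mx ord0 j) f x.

Definition grad f x : 'rV[R]_d := \row_j partial j f x.

Definition div (F : 'rV[R]_d -> 'rV[R]_d) x : R :=
  \sum_j partial j (fun y => F y ord0 j) x.

Definition potential (k : R -> R) x : R := k (eucl x).

(* [grad (potential k)] carries no information at the origin, where the
   potential need not be differentiable; the origin is a null set here. *)
Definition velocity (k : R -> R) w x : 'rV[R]_d :=
  \row_j (\int[lebesgue_tuple d]_t
    (grad (potential k) (x - point t) ord0 j * w (point t))).

Definition flux (k : R -> R) w x : 'rV[R]_d := w x *: velocity k w x.

Definition first_moment w : \bar R := integralRd (fun x => eucl x * w x).

Record initial_datum (u0 : 'rV[R]_d -> R) : Prop := {
  datum_ge0 : forall x, 0 <= u0 x ;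
  datum_integrable : integrableRd u0 ;
  datum_neq0 : ~ negligibly_zero u0 ;
  datum_even : forall x, u0 (- x) = u0 x ;
  datum_moment : (first_moment u0 < +oo)%E }.

Definition jointly_continuous_on (T : R) (g : R -> 'rV[R]_d -> R) :=
  forall t x, 0 < t < T -> {for (t, x), continuous (fun p => g p.1 p.2)}.

(* Classical solutions on [0, T): all terms of the equation exist and are
   continuous for 0 < t < T.  Since u0 is only integrable, it is attained in
   L^1; for a solution continuous up to t = 0 this follows from nonnegativity
   and conservation of mass (Scheffe).
   [sol_conv] makes the convolution well defined, and [sol_flux_L1] asks the
   flux to be integrable over space, locally boundedly in time: when k' is
   bounded by K0 it is automatic, with bound K0 M^2. *)
Record solution (k : R -> R) (u0 : 'rV[R]_d -> R) (T : R)
    (u : R -> 'rV[R]_d -> R) : Prop := {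
  sol_T : 0 < T ;
  sol_init : u 0 = u0 ;
  sol_init_L1 : integralRd (fun x => `|u t x - u0 x|) @[t --> 0^'+] --> 0%E ;
  sol_ge0 : forall t x, 0 < t < T -> 0 <= u t x ;
  sol_even : forall t x, 0 < t < T -> u t (- x) = u t x ;
  sol_mass : forall t, 0 < t < T -> integralRd (u t) = integralRd u0 ;
  sol_cont : jointly_continuous_on T u ;
  sol_dt : forall t x, 0 < t < T -> derivable (u^~ x) t 1 ;
  sol_dt_cont : jointly_continuous_on T (fun t x => derive1 (u^~ x) t) ;
  sol_conv : forall t x j, 0 < t < T ->
    integrableRd (fun y => grad (potential k) (x - y) ord0 j * u t y) ;
  sol_flux_cont : forall j,
    jointly_continuous_on T (fun t x => flux k (u t) x ord0 j) ;
  sol_flux_dx : forall t x j, 0 < t < T ->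
    derivable (fun y => flux k (u t) y ord0 j) x (delta_mx ord0 j) ;
  sol_flux_dx_cont : forall j, jointly_continuous_on T
    (fun t => partial j (fun y => flux k (u t) y ord0 j)) ;
  sol_flux_L1 : forall T', T' < T -> exists C : R, forall t j, 0 < t <= T' ->
    (integralRd (fun x => `|flux k (u t) x ord0 j|%R) <= C%:E)%E ;
  sol_eq : forall t x, 0 < t < T ->
    derive1 (u^~ x) t + div (flux k (u t)) x = 0 }.

Definition ceases_to_exist (k : R -> R) (u0 : 'rV[R]_d -> R) :=
  exists Tmax : R, forall T u, solution k u0 T u -> T <= Tmax.

End space.

Definition locally_lipschitz (k : R -> R) :=
  [locally [lipschitz k r | r in `[0, +oo[%classic]].

Definition condH1 (k : R -> R) :=
  [/\ forall r, 0 < r -> derivable k r 1,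
      exists2 K0, 0 < K0 & forall r, 0 < r -> - K0 <= derive1 k r <= 0
    & forall r0, 0 < r0 -> 0 < - sup [set derive1 k r | r in `]0, r0[%classic] ].

Definition condH2 (k : R -> R) (K0 K1 K2 delta : R) :=
  [/\ 0 < K0, 0 < K1, 0 <= K2, 0 <= delta < 1
    & exists k1 k2 : R -> R, forall r, 0 < r ->
      [/\ derivable k r 1, derivable k1 r 1 & derivable k2 r 1] /\
      [/\ derive1 k r = - derive1 k1 r + derive1 k2 r,
          `|derive1 k r| <= K0 * (1 + r `^ delta),
          K1 <= derive1 k1 r
        & derive1 k2 r <= K2 * r `^ delta] ].

(* For delta = 0 and K1 <= K2, [condH2] admits k = 0, for which every solution
   is stationary, hence global, however small its first moment. *)
Lemma condH2_zero : condH2 (fun=> 0) 1 1 1 0.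
Proof.
split=> //; first by rewrite lexx ltr01.
exists id, id => r r0; split; first by split.
split; rewrite ?derive1_cst ?derive1_id ?addNr ?powRr0 ?mulr1//.
by rewrite normr0 mul1r addr_ge0.
Qed.

Lemma grad_potential_zero d : grad (potential (fun=> 0 : R)) = fun=> 0 :> 'rV[R]_d.
Proof.
apply/funext => x; apply/rowP => j; rewrite !mxE /partial /potential.
exact: derive_cst.
Qed.

Lemma solution_zero d (u0 : 'rV[R]_d -> R) (T : R) : 0 < T ->
  initial_datum u0 -> continuous u0 -> solution (fun=> 0) u0 T (fun=> u0).
Proof.
move=> T0 [u0_ge0 u0_int u0_neq0 u0_even u0_mom] u0_cont.
have gradE (x : 'rV[R]_d) j : grad (potential (fun=> 0 : R)) x ord0 j = 0.
  by rewrite grad_potential_zero mxE.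
have flux0 (x : 'rV[R]_d) : flux (fun=> 0) u0 x = 0.
  apply/rowP => j; rewrite !mxE /Rintegral integral0_eq ?mulr0// => t _.
  by rewrite gradE mul0r.
have fluxE (j : 'I_d) : (fun x => flux (fun=> 0) u0 x ord0 j) = cst 0.
  by apply/funext => x; rewrite flux0 mxE.
have partialE (j : 'I_d) : partial j (fun x => flux (fun=> 0) u0 x ord0 j) = cst 0.
  by rewrite fluxE; apply/funext => x; exact: derive_cst.
have cont0 (g : R -> 'rV[R]_d -> R) :
    (forall t x, g t x = 0) -> jointly_continuous_on T g.
  move=> g0; have -> : g = fun=> cst 0 by apply/funext => t; apply/funext => x.
  by move=> t x _; exact: cst_continuous.
split=> //.
- under eq_fun do rewrite /integralRd.
  under eq_fun do under eq_integral do rewrite subrr normr0.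
  by rewrite integral0; exact: cvg_cst.
- by move=> t x _ /=; apply: continuous_comp; [exact: cvg_snd|exact: u0_cont].
- by apply: cont0 => t x; rewrite derive1_cst.
- move=> t x j _; rewrite /integrableRd.
  by under eq_fun do rewrite gradE mul0r; exact: integrable0.
- by move=> j; apply: cont0 => t x; rewrite flux0 mxE.
- by move=> t x j _; rewrite fluxE.
- by move=> j; apply: cont0 => t x; rewrite partialE.
- move=> T' _; exists 0 => t j _; rewrite /integralRd.
  by under eq_integral do rewrite flux0 mxE normr0; rewrite integral0.
- move=> t x _; rewrite derive1_cst add0r /div.
  by apply: big1 => j _; rewrite partialE.
Qed.

End aggregation.

(* Main.v *)
Require Import Defs.
From HB Require Import structures.
From mathcomp Require Import all_boot all_order all_algebra.
From mathcomp Require Import all_classical all_reals all_analysis.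
From mathcomp Require Import measurable_realfun.
From mathcomp Require Import ring lra.

Import Order.TTheory GRing.Theory Num.Theory numFieldNormedType.Exports.
Local Open Scope classical_set_scope.
Local Open Scope ring_scope.

(** The first moment m(t) of a solution u, the integral of |x| u(t,x), is a
Lyapunov functional.  Symmetrizing in x and y, one finds formally
  m' = 1/2 \iint (x/|x| - y/|y|) . (x-y)/|x-y| k'(|x-y|) u(x) u(y) dx dy.
The geometric factor equals (|x|+|y|)/|x-y| (1 - x/|x| . y/|y|), hence is at
least 1 - x/|x| . y/|y|, and the integral of x/|x| u(x) vanishes because u is
even.  Therefore, if k'(r) <= - kap + L r for all r > 0 and M is the mass,
  m' <= - kap M^2 / 2 + 2 L M m.
Once 16 L m <= kap M, the nonnegative quantity m decreases at a fixed rate,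
which cannot last ([existence_time_le]).  All the conditions on k provide such
an affine bound: under (H1), L = kap / r0 with r0 as large as the first moment
requires ([condH1_derive_le]); under (H2) with K2 = 0, L = 0; under (H2) with
delta > 0, because K2 r^delta <= K1 / 2 + L r for a suitable L
([powR_le_affine]), in which case the moment has to be small; and under (H2)
with delta = 0, again L = 0, the hypothesis K2 < K1 making kap = K1 - K2
positive.

A solution comes without decay at infinity except for the integrability of the
flux, and |x| is not differentiable at the origin, so the computation is carried
out with the test functions
  psi = <x> Z,  <x> = sqrt(e^2 + |x|^2),  Z = max(0, 1 - h ln(1 + |x|^2))^2,
which are continuously differentiable with compact support.  As the cutoff is
logarithmic, its gradient times <x> is bounded by 4 h, and 1 - Z <= 4 h |x|.
The sublinear growth of k' at infinity then makes the effect of the cutoff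
uniformly small as h tends to 0 ([sum_Int_test_grad_flux_le]).

Smoothing |x| at the origin replaces M^2 by M^2 - E^2, where E is the integral
of e/<x> u, essentially the mass within distance e of the origin.  This loss is
what the smoothing must cost, since for a fixed e nothing prevents concentration
at the origin; but on a time interval [lo, T'] with 0 < lo and T' before the
end of existence, u is bounded near the origin, and e can be chosen so that
E <= M/2 ([core_mass_small]).  On the initial interval ]0, lo] a crude bound by
the L^1 norm of the flux suffices ([mom_bound]): it shows that the moment grows
at most linearly.  The same bound shows that the moment is almost constant over
a short step, so that the sharp inequality can be applied step by step
([mom_step], [mom_iterate]). *)

(** * Lebesgue measure on R^n *)

Section tuple_measure.
Context {R : realType}.
Local Notation mR := (measurableTypeR R).
Local Notation pt := (@Defs.point R _).

(** The preimage of an open set is a countable union of boxes with rational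
centre and rational radius, and boxes are measurable in the product
sigma-algebra. *)
Lemma measurable_point_comp n (f : 'rV[R]_n -> R) : continuous f ->
  measurable_fun setT (fun t : n.-tuple mR => f (pt t)).
Proof.
move=> cf; apply: (measurability _ (RGenOpens.measurableE R)) => //.
move=> _ [_ [a [b ->]] <-]; rewrite setTI.
have oU : open (f @^-1` (`]a, b[%classic : set R)).
  by apply: open_comp; [move=> x _; exact: cf|exact: interval_open].
set U := f @^-1` (`]a, b[%classic : set R) in oU.
pose side (q : n.-tuple rat * rat) i : set R :=
  `](ratr (tnth q.1 i) - ratr q.2), (ratr (tnth q.1 i) + ratr q.2)[%classic.
pose box (q : n.-tuple rat * rat) := [set t : n.-tuple mR | forall i, side q i (tnth t i)].
have mbox q : measurable (box q) by apply: (@measurable_box R n (side q)) => i; exact: measurable_itv.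
suff -> : (fun t : n.-tuple mR => f (pt t)) @^-1` (`]a, b[%classic : set R) =
    \bigcup_q (if `[< forall t, box q t -> U (pt t) >] then box q else set0).
  by apply: countable_bigcupT_measurable => // q; case: ifPn.
apply/seteqP; split => [t /= Ut|t [q _]]; last first.
  by case: ifPn => // /asboolP; apply.
have : nbhs (pt t) U by apply: open_nbhs_nbhs; split.
move=> /nbhs_ballP[e /= e0 eU].
have [r /= /andP[r0 re]] : exists r : rat, (0 : R) < ratr r < e / 2.
  have [r] := @rat_in_itvoo R 0 (e / 2) ltac:(by rewrite divr_gt0).
  by rewrite in_itv /= => ?; exists r.
have qP (i : 'I_n) : exists q : rat, tnth t i - ratr r < ratr q < tnth t i + ratr r.
  have [q] := @rat_in_itvoo R (tnth t i - ratr r) (tnth t i + ratr r) ltac:(by lra).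
  by rewrite in_itv /= => ?; exists q.
have [q qt] := choice qP.
exists ([tuple q i | i < n], r) => //.
case: ifPn => [_|/asboolP[]] /=.
  move=> i; rewrite /side /= tnth_mktuple in_itv /=.
  by have := qt i; lra.
move=> s sq; apply: eU; split => // i j; rewrite !mxE.
have := sq j; rewrite /side /= tnth_mktuple in_itv /= => sj.
rewrite /ball /= ltr_norml.
by have := qt j; lra.
Qed.

(** An alias of the Lebesgue measure, to which sigma-finiteness can be attached. *)
Definition leb n : set (n.-tuple mR) -> \bar R := lebesgue_tuple n.
HB.instance Definition _ n := Measure.on (@leb n).

Lemma leb_sigma_finite n : sigma_finite setT (@leb n).
Proof.
exists (fun k => [set t : n.-tuple mR | forall i, (`[- k%:R, k%:R]%classic : set R) (tnth t i)]).
  apply/esym/seteqP; split => // t _.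
  exists (\sum_(i < n) Num.bound (tnth t i))%N => // i.
  have : (Num.bound (tnth t i) <= (\sum_(i < n) Num.bound (tnth t i)))%N.
    by rewrite (bigD1 i) //= leq_addr.
  rewrite -(@ler_nat R) /= in_itv /=.
  by have := unstable.ltr_norm_bound (tnth t i); rewrite ltr_norml; lra.
move=> k; split; first exact: (measurable_box (A := fun=> `[- k%:R, k%:R]%classic)).
rewrite /leb (lebesgue_tuple_box (A := fun=> `[- k%:R, k%:R]%classic)) //.
pose I : set R := `[- k%:R, k%:R]%classic; rewrite -/I.
suff /andP[] : (0 <= \prod_(i < n) lebesgue_measure I < +oo)%E by [].
elim/big_ind : _ => [|x y /andP[x0 xy] /andP[y0 yy]|i _].
- by rewrite lee_fin ler01 ltry.
- by rewrite mule_ge0//= lte_mul_pinfty// ge0_fin_numE.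
- by rewrite measure_ge0/= lebesgue_measure_itv /=; case: ifPn => _; rewrite ?ltry.
Qed.
HB.instance Definition _ n := @Measure_isSigmaFinite.Build _ _ _ (@leb n) (@leb_sigma_finite n).

Lemma ge0_integral_leb_cons n (f : n.+1.-tuple mR -> \bar R) :
  measurable_fun setT f -> (forall t, 0 <= f t)%E ->
  (\int[leb n.+1]_t f t =
   \int[(leb n \x lebesgue_measure)%E]_z f (tuple_cons z))%E.
Proof.
move=> mf f0.
by rewrite (ge0_integral_pushforward (@measurable_tuple_cons R n)).
Qed.

Lemma integral_leb_cons n (f : n.+1.-tuple mR -> \bar R) :
  (leb n.+1).-integrable setT f ->
  (leb n \x lebesgue_measure)%E.-integrable setT (f \o @tuple_cons R n) /\
  (\int[leb n.+1]_t f t =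
   \int[(leb n \x lebesgue_measure)%E]_z f (tuple_cons z))%E.
Proof.
move=> intf; have mf := measurable_int _ intf.
have i1 : (leb n \x lebesgue_measure)%E.-integrable setT (f \o @tuple_cons R n).
  apply/integrableP; split.
    by apply: measurableT_comp => //; exact: measurable_tuple_cons.
  have /integrableP[_] := intf.
  by rewrite ge0_integral_leb_cons//; exact: measurableT_comp.
split => //.
by rewrite (integral_pushforward (@measurable_tuple_cons R n)).
Qed.

Definition tuple_opp n (t : n.-tuple mR) : n.-tuple mR := [tuple - tnth t i | i < n].

Lemma measurable_tuple_opp n : measurable_fun setT (@tuple_opp n).
Proof.
apply/measurable_fun_tnthP => i; rewrite /comp.
under eq_fun do rewrite tnth_mktuple.
by apply: measurable_funN; exact: measurable_tnth.
Qed.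

Lemma tuple_opp_cons n z : tuple_opp n.+1 (tuple_cons z) = tuple_cons (tuple_opp n z.1, - z.2).
Proof.
apply: eq_from_tnth => i; rewrite tnth_mktuple.
have [j ->|->] := unliftP ord0 i; last by rewrite !tnth0.
by rewrite !tnthS tnth_mktuple.
Qed.

(** Induction on the dimension: by Tonelli, the tail and the head can be negated
one after the other. *)
Lemma ge0_integral_tuple_opp n (f : n.-tuple mR -> \bar R) :
  measurable_fun setT f -> (forall t, 0 <= f t)%E ->
  (\int[leb n]_t f (tuple_opp n t) = \int[leb n]_t f t)%E.
Proof.
elim: n f => [|n IH] f mf f0.
  by apply: eq_integral => t _; congr f; rewrite (tuple0 t) tuple0.
have mfc : measurable_fun setT (f \o @tuple_cons R n).
  by apply: measurableT_comp => //; exact: measurable_tuple_cons.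
rewrite ge0_integral_leb_cons//; last first.
  by apply: measurableT_comp => //; exact: measurable_tuple_opp.
rewrite [RHS]ge0_integral_leb_cons//.
under eq_integral do rewrite tuple_opp_cons.
set g := fun z : n.-tuple mR * mR => f (tuple_cons z).
have mg2 : measurable_fun setT (fun z : n.-tuple mR * mR => g (z.1, - z.2)).
  apply: (measurableT_comp mfc); apply: measurable_fun_pair.
    exact: measurable_fst.
  by apply: measurable_funN; exact: measurable_snd.
have mg3 : measurable_fun setT (fun z : n.-tuple mR * mR => g (tuple_opp n z.1, - z.2)).
  apply: (measurableT_comp mfc); apply: measurable_fun_pair.
    by apply: measurableT_comp; [exact: measurable_tuple_opp|exact: measurable_fst].
  by apply: measurable_funN; exact: measurable_snd.
have ton1 (q : n.-tuple mR * mR -> \bar R) : measurable_fun setT q -> (forall z, 0 <= q z)%E ->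
    (\int[(leb n \x lebesgue_measure)%E]_z q z = \int[leb n]_t \int[lebesgue_measure]_x q (t, x))%E.
  by move=> mq q0; exact: (@fubini_tonelli1 _ _ _ _ _ (leb n) lebesgue_measure q mq q0).
have ton2 (q : n.-tuple mR * mR -> \bar R) : measurable_fun setT q -> (forall z, 0 <= q z)%E ->
    (\int[(leb n \x lebesgue_measure)%E]_z q z = \int[lebesgue_measure]_x \int[leb n]_t q (t, x))%E.
  by move=> mq q0; exact: (@fubini_tonelli2 _ _ _ _ _ (leb n) lebesgue_measure q mq q0).
transitivity (\int[(leb n \x lebesgue_measure)%E]_z g (z.1, (- z.2)%R))%E.
  apply: etrans (ton2 _ mg3 (fun=> f0 _)) _; apply: etrans _ (esym (ton2 _ mg2 (fun=> f0 _))).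
  apply: eq_integral => x _.
  apply: (IH (fun t => g (t, - x))); last by move=> t; exact: f0.
  exact: (@measurable_fun_pair1 _ _ _ _ _ _ _ (- x : mR) mfc).
apply: etrans (ton1 _ mg2 (fun=> f0 _)) _; apply: etrans _ (esym (ton1 _ mfc (fun=> f0 _))).
apply: eq_integral => t _.
have mgt : measurable_fun setT (fun x : mR => g (t, x)) by exact: (@measurable_fun_pair2 _ _ _ _ _ _ _ t mfc).
have moN : measurable_fun setT (-%R : mR -> mR) by exact: measurable_funN.
rewrite -[LHS](ge0_integral_pushforward moN lebesgue_measure measurableT mgt (fun _ _ => f0 _)).
apply: eq_measure_integral => A mA _; exact: lebesgue_measureN.
Qed.

Lemma integral_odd0 n (f : n.-tuple mR -> R) :
  (leb n).-integrable setT (EFin \o f) -> (forall t, f (tuple_opp n t) = - f t) ->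
  (\int[leb n]_t (f t)%:E = 0)%E.
Proof.
move=> intf fN; rewrite integralE.
have mf := measurable_int _ intf.
have -> : (\int[leb n]_t ((EFin \o f)^\+ t) = \int[leb n]_t ((EFin \o f)^\- t))%E.
  rewrite -[RHS]ge0_integral_tuple_opp//; last exact: measurable_funeneg.
  by apply: eq_integral => t _; rewrite funeposE funenegE /= fN ?EFinN ?opprK ?oppeK.
by rewrite subee//; exact: integrable_neg_fin_num.
Qed.

Definition axis_line n (j : 'I_n) (s : R) (t : n.-tuple mR) : n.-tuple mR :=
  [tuple if i == j then s else tnth t i | i < n].

Lemma axis_line0_cons n (t : n.-tuple mR) (x s : mR) :
  axis_line n.+1 ord0 s (tuple_cons (t, x)) = tuple_cons (t, s).
Proof.
apply: eq_from_tnth => i; rewrite tnth_mktuple.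
have [j ->|->] := unliftP ord0 i; last by rewrite eqxx tnth0.
by rewrite !tnthS.
Qed.

Lemma axis_lineS_cons n (j : 'I_n) (t : n.-tuple mR) (x s : mR) :
  axis_line n.+1 (lift ord0 j) s (tuple_cons (t, x)) = tuple_cons (axis_line n j s t, x).
Proof.
apply: eq_from_tnth => i; rewrite tnth_mktuple.
have [l ->|->] := unliftP ord0 i; last by rewrite !tnth0.
by rewrite !tnthS tnth_mktuple (inj_eq lift_inj).
Qed.

(** Fubini, with the j-th coordinate as innermost variable.  As only almost every
section of f is integrable, the induction hypothesis holds almost everywhere. *)
Lemma integral_lines0 n (j : 'I_n) (f : n.-tuple mR -> R) :
  (leb n).-integrable setT (EFin \o f) ->
  (forall t, \int[lebesgue_measure]_s (f (axis_line n j s t))%:E = 0)%E ->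
  (\int[leb n]_t (f t)%:E = 0)%E.
Proof.
elim: n j f => [[]//|n IH] j f /integral_leb_cons[intf ->] f0.
have [l jl|j0] := unliftP ord0 j.
- rewrite -(integral21_prod_meas1 intf) -(integral0 lebesgue_measure setT).
  apply: ae_eq_integral => //; first exact: (measurable_fubini_G intf).
  apply: filterS (ae_integrable2 intf) => x intx _ /=.
  apply: (IH l (fun t => f (tuple_cons (t, x)))) => // t.
  by under eq_integral do rewrite -axis_lineS_cons -jl.
- rewrite -(integral12_prod_meas1 intf).
  apply: integral0_eq => t _; rewrite /fubini_F /=.
  rewrite -(f0 (tuple_cons (t, 0))); apply: eq_integral => x _.
  by rewrite j0 axis_line0_cons.
Qed.

End tuple_measure.

(** * Integration by parts with compact support *)

Section compact_support.
Context {R : realType}.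
Local Notation mR := (measurableTypeR R).
Local Notation pt := (@Defs.point R _).

Lemma is_derive_line n (G : 'rV[R]_n -> R) (x v : 'rV[R]_n) (s l : R) :
  is_derive (x + s *: v) v G l -> is_derive s 1 (fun r => G (x + r *: v)) l.
Proof.
move=> [dG eG].
have E : (fun h : R => h^-1 *: (G (h *: v + (x + s *: v)) - G (x + s *: v))) =
         (fun h : R => h^-1 *: (G (x + (h *: 1 + s) *: v) - G (x + s *: v))).
  apply/funext => h; congr (_ *: (G _ - _)).
  by rewrite addrCA -scalerDl; congr (_ + (_ + _) *: _); rewrite /GRing.scale /= mulr1.
by apply: DeriveDef; [rewrite /derivable -E|rewrite /derive -E].
Qed.

Lemma integral_derive_compact (f f' : R -> R) (a : R) :
  (forall s : R, is_derive s 1 f (f' s)) -> continuous f' ->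
  (forall s : R, a < `|s| -> f s = 0 /\ f' s = 0) ->
  (\int[lebesgue_measure]_s (f' s)%:E = 0)%E.
Proof.
move=> df cf f0.
pose b : R := `|a| + 1.
have ab : a < b by rewrite /b; have := ler_norm a; lra.
have b0 : 0 < b by rewrite /b; have := normr_ge0 a; lra.
transitivity (\int[lebesgue_measure]_(s in `[(- b)%R, b]) (f' s)%:E)%E.
  rewrite [RHS]integral_mkcond; apply: eq_integral => s _; rewrite patchE.
  case: ifPn => //; rewrite notin_setE /= in_itv /= => sb.
  rewrite (f0 s _).2 // (lt_le_trans ab)// ltW// ltNge ler_norml.
  exact/negP.
have cF : continuous f.
  by move=> s; apply: differentiable_continuous; apply/derivable1_diffP; case: (df s).
rewrite (@continuous_FTC2 R f' f (- b) b).
- by rewrite !(f0 _ _).1 ?subee// ?normrN ger0_norm// ltW.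
- by lra.
- exact: continuous_subspaceT.
- split.
  + by move=> s _; case: (df s).
  + exact/cvg_at_right_filter/cF.
  + exact/cvg_at_left_filter/cF.
- by move=> s _; rewrite derive1E; exact: derive_val.
Qed.

Lemma pt_axis_line n (j : 'I_n) (s : R) (t : n.-tuple mR) :
  pt (axis_line n j s t) = pt (axis_line n j 0 t) + s *: delta_mx ord0 j.
Proof.
apply/rowP => i; rewrite !mxE !tnth_mktuple eqxx /=.
by case: eqP => _; rewrite ?mulr1 ?mulr0 ?add0r ?addr0.
Qed.

Lemma le_coord_norm n (x : 'rV[R]_n) (i : 'I_n) : `|x ord0 i| <= `|x|.
Proof.
rewrite [`|x|]mx_normrE; exact: (@Order.TotalTheory.le_bigmax _ _ _ 0 (fun i : 'I_1 * 'I_n => `|x i.1 i.2|) (ord0, i)).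
Qed.

Definition box n (a : R) : set (n.-tuple mR) :=
  [set t | forall i, (`[- a, a]%classic : set R) (tnth t i)].

Lemma measurable_box_sym n (a : R) :
  measurable (box n a).
Proof.
by apply: (@measurable_box R n (fun=> `[- a, a]%classic)) => i; exact: measurable_itv.
Qed.

Lemma leb_box_lty n (a : R) :
  (leb n (box n a) < +oo)%E.
Proof.
rewrite /leb (@lebesgue_tuple_box R n (fun=> `[- a, a]%classic)); last first.
  by move=> i; exact: measurable_itv.
set I : set R := `[- a, a]%classic.
suff /andP[] : (0 <= \prod_(i < n) lebesgue_measure I < +oo)%E by [].
elim/big_ind : _ => [|x y /andP[x0 xy] /andP[y0 yy]|i _].
- by rewrite lee_fin ler01 ltry.
- by rewrite mule_ge0//= lte_mul_pinfty// ge0_fin_numE.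
- by rewrite measure_ge0/= lebesgue_measure_itv /=; case: ifPn => _; rewrite ?ltry.
Qed.

Lemma compact_ball_norm n (a : R) : compact [set x : 'rV[R]_n | forall i, `[- a, a]%classic (x ord0 i)].
Proof. by apply: (@rV_compact R n (fun=> `[- a, a]%classic)) => i; exact: segment_compact. Qed.

Lemma point_in_box n (a : R) (t : n.-tuple mR) : `|pt t| <= a ->
  box n a t.
Proof.
move=> ta i; rewrite /= in_itv /= -ler_norml (le_trans _ ta)//.
by have := le_coord_norm n (pt t) i; rewrite mxE.
Qed.

Lemma integrable_box_bounded n (f : 'rV[R]_n -> R) (a C : R) :
  measurable_fun setT (fun t : n.-tuple mR => f (pt t)) ->
  (forall x, `|f x| <= C) -> (forall x, a < `|x| -> f x = 0) ->
  (leb n).-integrable setT (fun t => (f (pt t))%:E).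
Proof.
move=> mf fC f0.
set B := box n a.
have mB : measurable B by exact: measurable_box_sym.
have iB : (leb n).-integrable setT (fun t => (C * \1_B t)%:E).
  under eq_fun do rewrite EFinM.
  apply: (integrableZl measurableT); apply/integrableP; split.
    by apply/measurable_EFinP; apply: measurable_indic.
  under eq_integral do rewrite gee0_abs ?lee_fin//.
  by rewrite integral_indic// setIT; exact: leb_box_lty.
apply: (le_integrable _ _ _ iB) => //; first exact/measurable_EFinP.
move=> t _; rewrite lee_fin.
have [ta|ta] := leP `|pt t| a; last first.
  by rewrite (f0 _ ta) normr0.
by rewrite indicE mem_set ?mulr1; [exact: (le_trans (fC _) (ler_norm _))|exact: point_in_box].
Qed.

Lemma continuous_compact_support_bounded n (f : 'rV[R]_n -> R) (a : R) :
  continuous f -> (forall x, a < `|x| -> f x = 0) ->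
  exists2 C, 0 <= C & forall x, `|f x| <= C.
Proof.
move=> cf f0.
have := compact_bounded (continuous_compact (continuous_subspaceT cf) (compact_ball_norm n a)).
move=> [M [Mr]] /(_ (`|M| + 1)) MB.
exists (`|M| + 1) => [|x]; first by rewrite addr_ge0.
have [xa|xa] := leP `|x| a; last by rewrite f0// normr0 addr_ge0.
apply: MB; first by have := ler_norm M; lra.
exists x => // i; rewrite /= in_itv /= -ler_norml (le_trans _ xa)//.
exact: le_coord_norm.
Qed.

Lemma integrable_compact_support n (f : 'rV[R]_n -> R) (a : R) :
  continuous f -> (forall x, a < `|x| -> f x = 0) ->
  (leb n).-integrable setT (fun t => (f (pt t))%:E).
Proof.
move=> cf f0; have [C _ fC] := continuous_compact_support_bounded _ _ _ cf f0.
by apply: (integrable_box_bounded _ _ a C) => //; exact: measurable_point_comp.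
Qed.

(** The divergence theorem for one coordinate: on each line parallel to the j-th
axis the derivative integrates to 0 by the fundamental theorem of calculus. *)
Lemma integral_partial_compact n (j : 'I_n) (G DG : 'rV[R]_n -> R) (a : R) :
  (forall x, is_derive x (delta_mx ord0 j : 'rV[R]_n) G (DG x)) -> continuous DG ->
  (forall x, a < `|x| -> G x = 0 /\ DG x = 0) ->
  (\int[leb n]_t (DG (pt t))%:E = 0)%E.
Proof.
move=> dG cDG G0.
apply: (integral_lines0 _ j).
  by apply: (integrable_compact_support _ _ a) => // x /G0[].
move=> t; under eq_integral do rewrite pt_axis_line.
set x := pt (axis_line n j 0 t).
apply: (@integral_derive_compact (fun s => G (x + s *: delta_mx ord0 j)) _ a).
- by move=> s; apply: is_derive_line; exact: dG.
- move=> s; apply: (@continuous_comp _ _ _ (fun s : R => x + s *: (delta_mx ord0 j : 'rV[R]_n)) DG); last exact: cDG.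
  apply: cvgD; first exact: cvg_cst.
  by apply: cvgZr_tmp; exact: cvg_id.
- move=> s sa; apply: G0; apply: (lt_le_trans sa).
  have := le_coord_norm n (x + s *: delta_mx ord0 j) j.
  by rewrite !mxE tnth_mktuple !eqxx mulr1 add0r.
Qed.

End compact_support.

(** * The test functions *)

Section continuity.
Context {R : realType} {T : topologicalType}.
Implicit Types f g : T -> R.

Lemma continuous_const (c : R) : continuous (fun _ : T => c).
Proof. by move=> x; exact: cst_continuous. Qed.

Lemma continuous_add f g : continuous f -> continuous g -> continuous (fun x => f x + g x).
Proof. by move=> cf cg x; apply: cvgD; [exact: cf|exact: cg]. Qed.

Lemma continuous_opp f : continuous f -> continuous (fun x => - f x).
Proof. by move=> cf x; apply: cvgN; exact: cf. Qed.

Lemma continuous_mul f g : continuous f -> continuous g -> continuous (fun x => f x * g x).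
Proof. by move=> cf cg x; apply: cvgM; [exact: cf|exact: cg]. Qed.

Lemma continuous_inv f : (forall x, f x != 0) -> continuous f -> continuous (fun x => (f x)^-1).
Proof. by move=> f0 cf x; apply: cvgV; [exact: f0|exact: cf]. Qed.

Lemma continuous_compose f (g : R -> R) : continuous f -> (forall x, {for f x, continuous g}) ->
  continuous (fun x => g (f x)).
Proof. by move=> cf cg x; apply: continuous_comp; [exact: cf|exact: cg]. Qed.

Lemma continuous_max0 f : continuous f -> continuous (fun x => Num.max 0 (f x)).
Proof.
move=> cf x; apply: (@continuous_max R T (fun=> 0) f x); last exact: cf.
exact: continuous_const.
Qed.

End continuity.

Section test_function.
Context {R : realType}.

(** Polynomial along lines, hence easier to differentiate than [eucl]. *)
Definition nsq n (x : 'rV[R]_n) : R := \sum_i x ord0 i ^+ 2.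
Definition bracket n (e : R) (x : 'rV[R]_n) : R := Num.sqrt (e ^+ 2 + nsq n x).
Definition cutoff n (h : R) (x : 'rV[R]_n) : R := Num.max 0 (1 - h * ln (1 + nsq n x)) ^+ 2.
(** The compactly supported substitute for |x|: [bracket] smooths the origin at
scale e, and [cutoff] truncates infinity.  Large values of |x| are reached by the
cutoff only logarithmically, which keeps |x| times its gradient of order h. *)
Definition test_fun n (e h : R) (x : 'rV[R]_n) : R := bracket n e x * cutoff n h x.
Definition direction n (e : R) (j : 'I_n) (x : 'rV[R]_n) : R := x ord0 j / bracket n e x.
Definition cutoff_err n (e h : R) (j : 'I_n) (x : 'rV[R]_n) : R :=
  bracket n e x * (2 * Num.max 0 (1 - h * ln (1 + nsq n x)) * (- (h * (2 * x ord0 j / (1 + nsq n x))))).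
(** The j-th partial derivative of [test_fun]: the term that survives as h tends to 0,
and an error of order h. *)
Definition test_grad n (e h : R) (j : 'I_n) (x : 'rV[R]_n) : R :=
  cutoff n h x * direction n e j x + cutoff_err n e h j x.

Lemma nsq_ge0 n x : 0 <= nsq n x.
Proof. by apply: sumr_ge0 => i _; exact: sqr_ge0. Qed.

Lemma euclE n (x : 'rV[R]_n) : eucl x = Num.sqrt (nsq n x). Proof. by []. Qed.

Lemma nsqE n (x : 'rV[R]_n) : nsq n x = eucl x ^+ 2.
Proof. by rewrite sqr_sqrtr// nsq_ge0. Qed.

Lemma eucl_ge0 n (x : 'rV[R]_n) : 0 <= eucl x. Proof. exact: sqrtr_ge0. Qed.

Lemma nsqN n (x : 'rV[R]_n) : nsq n (- x) = nsq n x.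
Proof. by apply: eq_bigr => i _; rewrite mxE sqrrN. Qed.

Lemma continuous_coord n (j : 'I_n) : continuous (fun x : 'rV[R]_n => x ord0 j).
Proof. by move=> x; exact: coord_continuous. Qed.

Lemma continuous_nsq n : continuous (@nsq n).
Proof.
apply: (@continuous_big R _ _ _ _ _ _ _ (fun (i : 'I_n) (x : 'rV[R]_n) => x ord0 i ^+ 2)).
  by move=> x; apply: cvgD; [exact: cvg_fst|exact: cvg_snd].
move=> i _ x; apply: (@continuous_comp _ _ _ (fun x : 'rV[R]_n => x ord0 i) (fun r : R => r ^+ 2)).
  exact: continuous_coord.
exact: exprn_continuous.
Qed.

Lemma le_coord_eucl n (x : 'rV[R]_n) j : `|x ord0 j| <= eucl x.
Proof.
rewrite -sqrtr_sqr ler_wsqrtr// (bigD1 j)//= lerDl.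
by apply: sumr_ge0 => i _; exact: sqr_ge0.
Qed.

(** This form avoids case distinctions at points where the formula for f changes,
as for the square of the positive part. *)
Lemma is_derive_quadratic (f : R -> R) (s l C : R) :
  (forall h, `|f (s + h) - f s - h * l| <= C * h ^+ 2) -> is_derive s 1 f l.
Proof.
move=> fC; have C0 : 0 <= C.
  by have := fC 1; rewrite expr1n mulr1; exact: le_trans.
suff dl : (h^-1 *: (f (h *: 1 + s) - f s) @[h --> 0^'] --> l)%R.
  by apply: DeriveDef; [apply/cvg_ex; exists l|exact/cvg_lim].
apply/cvgrPdist_le => /= eps eps0; near=> h.
have h0 : h != 0 by near: h; exact: nbhs_dnbhs_neq.
have hC : `|h| <= eps / (C + 1).
  near: h; apply: dnbhs0_le; rewrite divr_gt0// ltr_wpDl//.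
rewrite [h%:A]/GRing.scale /= mulr1 (addrC h) -normrN opprB.
have -> : h^-1 *: (f (s + h) - f s) - l = h^-1 * (f (s + h) - f s - h * l).
  by rewrite [RHS]mulrBr mulrA mulVf// mul1r.
rewrite normrM normfV ler_pdivrMl ?normr_gt0//.
apply: (le_trans (fC h)); rewrite -(real_normK (num_real h)) expr2 mulrCA ler_wpM2l//.
rewrite ler_pdivlMr in hC; last by rewrite ltr_wpDl.
by have := normr_ge0 h; nra.
Unshelve. all: by end_near. Qed.

Lemma is_derive_sqpos (s : R) :
  is_derive s 1 (fun r : R => Num.max 0 r ^+ 2) (2 * Num.max 0 s).
Proof.
apply: (@is_derive_quadratic _ _ _ 1) => h; rewrite mul1r ler_norml.
by have [] := leP 0 s; have [] := leP 0 (s + h); nra.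
Qed.

Lemma nsq_line n (x : 'rV[R]_n) (j : 'I_n) (s : R) :
  nsq n (x + s *: delta_mx ord0 j) = nsq n x + 2 * s * x ord0 j + s ^+ 2.
Proof.
rewrite /nsq (bigD1 j)//= [in RHS](bigD1 j)//= !mxE !eqxx /= mulr1.
under eq_bigr => i ij do rewrite !mxE eqxx (negbTE ij) /= mulr0 addr0.
by ring.
Qed.

Lemma is_derive_of_line n (G : 'rV[R]_n -> R) (x v : 'rV[R]_n) (l : R) :
  is_derive (0 : R) 1 (fun r => G (x + r *: v)) l -> is_derive x v G l.
Proof.
move=> [dG eG].
have E : (fun h : R => h^-1 *: (G (h *: v + x) - G x)) =
         (fun h : R => h^-1 *: (G (x + (h *: 1 + 0) *: v) - G (x + 0 *: v))).
  apply/funext => h; congr (_ *: (G _ - G _)); last by rewrite scale0r addr0.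
  by rewrite addr0 addrC [h%:A]/GRing.scale /= mulr1.
by apply: DeriveDef; [rewrite /derivable E|rewrite /derive E].
Qed.

Section fixed.
Variables (n : nat) (e h : R).
Hypotheses (e0 : 0 < e) (e1 : e <= 1) (h0 : 0 < h).

Lemma bracket_arg_gt0 (x : 'rV[R]_n) : 0 < e ^+ 2 + nsq n x.
Proof. by rewrite ltr_wpDr ?nsq_ge0// exprn_gt0. Qed.

Lemma bracket_gt0 (x : 'rV[R]_n) : 0 < bracket n e x.
Proof. by rewrite sqrtr_gt0 bracket_arg_gt0. Qed.

Lemma sqr_bracket (x : 'rV[R]_n) : bracket n e x ^+ 2 = e ^+ 2 + nsq n x.
Proof. by rewrite sqr_sqrtr// ltW// bracket_arg_gt0. Qed.

Lemma is_derive_test j (x : 'rV[R]_n) :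
  is_derive x (delta_mx ord0 j : 'rV[R]_n) (test_fun n e h) (test_grad n e h j x).
Proof.
apply: is_derive_of_line.
have -> : (fun r : R => test_fun n e h (x + r *: delta_mx ord0 j)) =
  (fun r => Num.sqrt (e ^+ 2 + (nsq n x + 2 * r * x ord0 j + r ^+ 2))) *
  ((fun r : R => Num.max 0 r ^+ 2) \o (fun r => 1 - h * ln (1 + (nsq n x + 2 * r * x ord0 j + r ^+ 2)))).
  by apply/funext => r; rewrite /test_fun /bracket /cutoff nsq_line.
have dN (c : R) : is_derive (0 : R) 1 (fun r => c + (nsq n x + 2 * r * x ord0 j + r ^+ 2)) (2 * x ord0 j).
  apply: (@is_derive_quadratic _ _ _ 1) => k.
  rewrite [X in `|X|](_ : _ = k ^+ 2); last by ring.
  by rewrite normrX real_normK ?num_real// mul1r.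
have s0 : 0 < e ^+ 2 + (nsq n x + 2 * 0 * x ord0 j + 0 ^+ 2).
  by rewrite mulr0 mul0r expr0n /= !addr0 bracket_arg_gt0.
have l0 : 0 < 1 + (nsq n x + 2 * 0 * x ord0 j + 0 ^+ 2).
  by rewrite mulr0 mul0r expr0n /= !addr0 ltr_wpDr ?nsq_ge0.
have d1 := @is_derive1_comp R Num.sqrt (fun r => e ^+ 2 + (nsq n x + 2 * r * x ord0 j + r ^+ 2)) _ _ _ (is_derive1_sqrt s0) (dN (e ^+ 2)).
have d2 := @is_derive1_comp R (@ln R) (fun r => 1 + (nsq n x + 2 * r * x ord0 j + r ^+ 2)) _ _ _ (is_derive1_ln l0) (dN 1).
have d3 : is_derive (0 : R) 1 (fun r => 1 - h * ln (1 + (nsq n x + 2 * r * x ord0 j + r ^+ 2))) (- (h * (2 * x ord0 j / (1 + nsq n x)))).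
  have := is_deriveB (is_derive_cst (1 : R) (0 : R) 1) (is_deriveZ h d2).
  rewrite /= => d2'; apply: is_derive_eq d2' _.
  rewrite mulr0 mul0r expr0n /= !addr0 sub0r /GRing.scale /=.
  by congr (- (h * _)); rewrite mulrC.
have d4 := @is_derive1_comp R (fun r : R => Num.max 0 r ^+ 2) (fun r => 1 - h * ln (1 + (nsq n x + 2 * r * x ord0 j + r ^+ 2))) _ _ _ (is_derive_sqpos _) d3.
apply: is_derive_eq (is_deriveM d1 d4) _.
rewrite /= mulr0 mul0r expr0n /= !addr0.
rewrite /test_grad /direction /cutoff_err /cutoff -/(bracket n e x) /GRing.scale /=.
rewrite addrC; congr (_ + _).
  congr (_ * _); field; by rewrite gt_eqF// bracket_gt0.
Qed.

Lemma cutoff_ge0 (x : 'rV[R]_n) : 0 <= cutoff n h x.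
Proof. exact: sqr_ge0. Qed.

Lemma ln_nsq_ge0 (x : 'rV[R]_n) : 0 <= ln (1 + nsq n x).
Proof. by apply: ln_ge0; rewrite lerDl nsq_ge0. Qed.

Lemma pos_cut_ge0 (x : 'rV[R]_n) : 0 <= Num.max 0 (1 - h * ln (1 + nsq n x)).
Proof. by rewrite le_max lexx. Qed.

Lemma pos_cut_le1 (x : 'rV[R]_n) : Num.max 0 (1 - h * ln (1 + nsq n x)) <= 1.
Proof. by rewrite ge_max ler01 gerBl mulr_ge0 ?ln_nsq_ge0 ?ltW. Qed.

Lemma cutoff_le1 (x : 'rV[R]_n) : cutoff n h x <= 1.
Proof. by rewrite /cutoff expr_le1// ?pos_cut_ge0 ?pos_cut_le1. Qed.

(** From 1 - (1 - s)^2 <= 2 s with s = h ln(1 + |x|^2), and ln(1 + |x|^2) <= 2 |x|. *)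
Lemma onem_cutoff_le (x : 'rV[R]_n) : 1 - cutoff n h x <= 4 * h * eucl x.
Proof.
have L : ln (1 + nsq n x) <= 2 * eucl x.
  have E : ln (1 + nsq n x) <= ln ((1 + eucl x) ^+ 2).
    rewrite ler_ln ?posrE; last 2 first.
    - by rewrite ltr_wpDr ?nsq_ge0.
    - by rewrite exprn_gt0// ltr_wpDr ?eucl_ge0.
    by rewrite nsqE sqrrD expr1n mul1r; have := eucl_ge0 n x; lra.
  apply: (le_trans E); rewrite lnXn ?ltr_wpDr ?eucl_ge0// mulr2n.
  have := @le_ln1Dx R (eucl x); have := eucl_ge0 n x; lra.
have := ln_nsq_ge0 x; have := eucl_ge0 n x; rewrite /cutoff.
set r := eucl x in L *; set l := ln _ in L *.
have hl : h * l <= h * (2 * r) by rewrite ler_wpM2l// ltW.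
by move=> r0 l0; have [] := leP 0 (1 - h * l); nra.
Qed.

Lemma bracket_ge_eucl (x : 'rV[R]_n) : eucl x <= bracket n e x.
Proof. by rewrite ler_wsqrtr// lerDr sqr_ge0. Qed.

Lemma bracket_le (x : 'rV[R]_n) : bracket n e x <= eucl x + e.
Proof.
have r0 := eucl_ge0 n x.
rewrite -(ler_pXn2r (ltn0Sn 1)) ?nnegrE ?sqrtr_ge0 ?addr_ge0 ?(ltW e0)//.
by rewrite sqr_bracket nsqE; have := e0; nra.
Qed.

Lemma test_ge0 (x : 'rV[R]_n) : 0 <= test_fun n e h x.
Proof. by rewrite mulr_ge0 ?cutoff_ge0 ?sqrtr_ge0. Qed.

Lemma test_le (x : 'rV[R]_n) : test_fun n e h x <= bracket n e x.
Proof. by rewrite ler_piMr ?cutoff_le1 ?sqrtr_ge0. Qed.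

Lemma direction_le1 j (x : 'rV[R]_n) : `|direction n e j x| <= 1.
Proof.
rewrite normrM normfV (gtr0_norm (bracket_gt0 x)) ler_pdivrMr ?bracket_gt0// mul1r.
exact: (le_trans (le_coord_eucl _ x j) (bracket_ge_eucl x)).
Qed.

(** The factor <x> |x_j| / (1 + |x|^2) is at most 1 because e <= 1. *)
Lemma cutoff_err_le j (x : 'rV[R]_n) : `|cutoff_err n e h j x| <= 4 * h.
Proof.
rewrite /cutoff_err.
set m := Num.max _ _; set N := nsq n x; set b := bracket n e x.
have N0 : 0 <= N by exact: nsq_ge0.
have m0 : 0 <= m by exact: pos_cut_ge0.
have m1 : m <= 1 by exact: pos_cut_le1.
have b0 : 0 < b by exact: bracket_gt0.
have bN : b ^+ 2 <= 1 + N.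
  by rewrite sqr_bracket lerD2r expr_le1// ltW.
have xb : `|x ord0 j| <= b := le_trans (le_coord_eucl _ x j) (bracket_ge_eucl x).
have N1 : 0 < 1 + N by lra.
rewrite [X in `|X|](_ : _ = (4 * h) * (m * (b * - x ord0 j / (1 + N)))); last by field; lra.
rewrite normrM (@ger0_norm _ (4 * h)); last by have := h0; lra.
rewrite ler_piMr//; first by have := h0; lra.
rewrite normrM ger0_norm// mulr_ile1//.
rewrite !normrM normrN normfV (gtr0_norm b0) (gtr0_norm N1) ler_pdivrMr// mul1r.
by apply: le_trans bN; rewrite expr2 ler_pM2l.
Qed.

Lemma test_grad_le j (x : 'rV[R]_n) : `|test_grad n e h j x| <= 1 + 4 * h.
Proof.
apply: (le_trans (ler_normD _ _)); apply: lerD; last exact: cutoff_err_le.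
rewrite normrM (ger0_norm (cutoff_ge0 _)) mulr_ile1 ?cutoff_ge0 ?cutoff_le1//.
exact: direction_le1.
Qed.

Lemma cutoff_support (x : 'rV[R]_n) : expR h^-1 < `|x| ->
  Num.max 0 (1 - h * ln (1 + nsq n x)) = 0.
Proof.
move=> xh; apply/max_idPl; rewrite subr_le0.
have A1 : 1 <= expR h^-1.
  by apply: le_trans (expR_ge1Dx _); rewrite lerDl invr_ge0 ltW.
have xr : `|x| <= eucl x.
  have x0 : mx_norm x != 0 by rewrite gt_eqF// -[mx_norm x]/(`|x|); lra.
  have [i xi] := mx_norm_neq0 x0.
  rewrite [leLHS]xi; case: i {xi} => i1 i2 /=; rewrite (ord1 i1).
  exact: le_coord_eucl.
have : expR h^-1 <= 1 + nsq n x by rewrite nsqE; nra.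
have N1 : 0 < 1 + nsq n x by rewrite ltr_wpDr ?nsq_ge0.
rewrite -ler_ln ?posrE ?expR_gt0// expRK => H.
by rewrite -ler_pdivrMl// mulr1.
Qed.

Lemma test_support (x : 'rV[R]_n) : expR h^-1 < `|x| -> test_fun n e h x = 0.
Proof. by move=> /cutoff_support m0; rewrite /test_fun /cutoff m0 expr0n mulr0. Qed.

Lemma test_grad_support j (x : 'rV[R]_n) : expR h^-1 < `|x| -> test_grad n e h j x = 0.
Proof.
move=> /cutoff_support m0; rewrite /test_grad /cutoff /cutoff_err m0.
by rewrite expr0n !(mulr0, mul0r) addr0.
Qed.

Lemma continuous_bracket : continuous (bracket n e).
Proof.
apply: (@continuous_compose _ _ _ (@Num.sqrt R)); last by move=> x; exact: sqrt_continuous.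
by apply: continuous_add; [exact: continuous_const|exact: continuous_nsq].
Qed.

Lemma continuous_pos_cut : continuous (fun x => Num.max 0 (1 - h * ln (1 + nsq n x))).
Proof.
apply: continuous_max0.
apply: continuous_add; first exact: continuous_const.
apply: continuous_opp; apply: continuous_mul; first exact: continuous_const.
apply: (@continuous_compose _ _ (fun x => 1 + nsq n x) (@ln R)).
  by apply: continuous_add; [exact: continuous_const|exact: continuous_nsq].
by move=> x; apply: continuous_ln; rewrite ltr_wpDr ?nsq_ge0.
Qed.

Lemma continuous_cutoff : continuous (cutoff n h).
Proof.
apply: (@continuous_compose _ _ _ (fun r : R => r ^+ 2)); first exact: continuous_pos_cut.
by move=> x; exact: exprn_continuous.
Qed.

Lemma continuous_direction j : continuous (direction n e j).
Proof.
apply: continuous_mul; first exact: continuous_coord.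
apply: continuous_inv; last exact: continuous_bracket.
by move=> x; rewrite gt_eqF// bracket_gt0.
Qed.

Lemma continuous_test : continuous (test_fun n e h).
Proof. by apply: continuous_mul; [exact: continuous_bracket|exact: continuous_cutoff]. Qed.

Lemma continuous_test_grad j : continuous (test_grad n e h j).
Proof.
apply: continuous_add.
  by apply: continuous_mul; [exact: continuous_cutoff|exact: continuous_direction].
apply: continuous_mul; first exact: continuous_bracket.
apply: continuous_mul; first by apply: continuous_mul; [exact: continuous_const|exact: continuous_pos_cut].
apply: continuous_opp; apply: continuous_mul; first exact: continuous_const.
apply: continuous_mul; first by apply: continuous_mul; [exact: continuous_const|exact: continuous_coord].
apply: continuous_inv; first by move=> x; rewrite gt_eqF// ltr_wpDr ?nsq_ge0.
by apply: continuous_add; [exact: continuous_const|exact: continuous_nsq].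
Qed.

Lemma directionN j (x : 'rV[R]_n) : direction n e j (- x) = - direction n e j x.
Proof. by rewrite /direction /bracket nsqN mxE mulNr. Qed.

End fixed.
End test_function.

(** * Double integrals *)

Section product_integrals.
Context {R : realType} {d : measure_display} {T : measurableType d} {m : {sigma_finite_measure set T -> \bar R}}.

Lemma integrable_separable (f g : T -> R) :
  m.-integrable setT (EFin \o f) -> m.-integrable setT (EFin \o g) ->
  (m \x m)%E.-integrable setT (fun z => (f z.1 * g z.2)%:E).
Proof.
move=> fi gi.
have mf : measurable_fun setT f by apply/measurable_EFinP; exact: measurable_int fi.
have mg : measurable_fun setT g by apply/measurable_EFinP; exact: measurable_int gi.
apply/integrable12ltyP.
  apply/measurable_EFinP; apply: measurable_funM.
    by apply: measurableT_comp => //; exact: measurable_fst.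
  by apply: measurableT_comp => //; exact: measurable_snd.
have G (x : T) : (\int[m]_y `|(f x * g y)%:E| = `|f x|%:E * \int[m]_y `|(g y)%:E|)%E.
  under eq_integral do rewrite EFinM abseM.
  by rewrite ge0_integralZl//; apply/measurable_EFinP; exact: measurableT_comp.
under eq_integral do rewrite /= G.
have [_ gy] := integrableP _ _ _ gi.
have [_ fy] := integrableP _ _ _ fi.
have gf : (\int[m]_y `|(g y)%:E|)%E \is a fin_num.
  by rewrite ge0_fin_numE//; exact: integral_ge0.
rewrite -(fineK gf) ge0_integralZr//.
- apply: lte_mul_pinfty; [exact: integral_ge0| |exact: ltry].
  by rewrite ge0_fin_numE//; exact: integral_ge0.
- by apply/measurable_EFinP; exact: measurableT_comp.
- by rewrite lee_fin fine_ge0// integral_ge0.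
Qed.

Lemma Rintegral_separable (f g : T -> R) :
  m.-integrable setT (EFin \o f) -> m.-integrable setT (EFin \o g) ->
  (\int[(m \x m)%E]_z (f z.1 * g z.2) = (\int[m]_x f x) * (\int[m]_x g x))%R.
Proof.
move=> fi gi; rewrite /Rintegral -(integral12_prod_meas1 (integrable_separable f g fi gi)).
have G (x : T) : (\int[m]_y (f x * g y)%:E = (f x)%:E * \int[m]_y (g y)%:E)%E.
  by under eq_integral do rewrite EFinM; rewrite integralZl.
rewrite [X in fine X = _](eq_integral (fun x => (f x)%:E * \int[m]_y (g y)%:E)%E); last first.
  by move=> x _; exact: G.
have gf : (\int[m]_y (g y)%:E)%E \is a fin_num by exact: integrable_fin_num.
by rewrite -(fineK gf) integralZr// fineM//; exact: integrable_fin_num.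
Qed.

Lemma integrable_swap (H : T * T -> R) :
  (m \x m)%E.-integrable setT (EFin \o H) ->
  (m \x m)%E.-integrable setT (fun z => (H (z.2, z.1))%:E).
Proof.
move=> iH; have mH := measurable_int _ iH.
apply/integrable12ltyP.
  apply: (measurableT_comp mH).
  by apply: measurable_fun_pair; [exact: measurable_snd|exact: measurable_fst].
exact/(integrable21ltyP m m mH).
Qed.

Lemma Rintegral_swap (H : T * T -> R) :
  (m \x m)%E.-integrable setT (EFin \o H) ->
  (\int[(m \x m)%E]_z H (z.2, z.1) = \int[(m \x m)%E]_z H z)%R.
Proof.
move=> iH; rewrite /Rintegral -(integral12_prod_meas1 (integrable_swap H iH)).
by rewrite -(integral21_prod_meas1 iH).
Qed.

End product_integrals.

(** * Euclidean geometry *)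

Section euclidean.
Context {R : realType} {n : nat}.
Implicit Types x y : 'rV[R]_n.

Definition dot x y : R := \sum_i x ord0 i * y ord0 i.

(** Cauchy-Schwarz, from the sum of the squares of x_i |y| - y_i |x|. *)
Lemma dot_le x y : dot x y <= eucl x * eucl y.
Proof.
have [x0|x0] := eqVneq (eucl x) 0.
  rewrite x0 mul0r /dot big1// => i _.
  have := le_coord_eucl n x i; rewrite x0 normr_le0 => /eqP ->.
  by rewrite mul0r.
have [y0|y0] := eqVneq (eucl y) 0.
  rewrite y0 mulr0 /dot big1// => i _.
  have := le_coord_eucl n y i; rewrite y0 normr_le0 => /eqP ->.
  by rewrite mulr0.
have A : 0 < eucl x by rewrite lt_neqAle eq_sym x0 eucl_ge0.
have B : 0 < eucl y by rewrite lt_neqAle eq_sym y0 eucl_ge0.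
have : 0 <= \sum_i (x ord0 i * eucl y - y ord0 i * eucl x) ^+ 2.
  by apply: sumr_ge0 => i _; exact: sqr_ge0.
have -> : \sum_i (x ord0 i * eucl y - y ord0 i * eucl x) ^+ 2 =
    nsq n x * eucl y ^+ 2 - 2 * eucl x * eucl y * dot x y + nsq n y * eucl x ^+ 2.
  rewrite /nsq /dot !mulr_suml mulr_sumr -sumrB -big_split /=.
  by apply: eq_bigr => i _; ring.
rewrite !nsqE; set a := eucl x in A *; set b := eucl y in B *.
have ab : 0 < a * b by rewrite mulr_gt0.
by nra.
Qed.

Lemma dotN x y : dot x (- y) = - dot x y.
Proof. by rewrite /dot -sumrN; apply: eq_bigr => i _; rewrite mxE mulrN. Qed.

Lemma norm_dot_le x y : `|dot x y| <= eucl x * eucl y.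
Proof.
rewrite ler_norml dot_le andbT lerNl -dotN.
by rewrite (le_trans (dot_le _ _))// {2}/eucl -/(nsq n (- y)) nsqN.
Qed.

Lemma nsqD x y : nsq n (x + y) = nsq n x + 2 * dot x y + nsq n y.
Proof.
rewrite /nsq /dot mulr_sumr -!big_split /=.
by apply: eq_bigr => i _; rewrite mxE; ring.
Qed.

Lemma euclD_le x y : eucl (x + y) <= eucl x + eucl y.
Proof.
rewrite -(ler_pXn2r (ltn0Sn 1)) ?nnegrE ?sqrtr_ge0 ?addr_ge0 ?eucl_ge0//.
by rewrite -nsqE nsqD !nsqE; have := dot_le x y; nra.
Qed.

Lemma euclN x : eucl (- x) = eucl x.
Proof. by rewrite euclE nsqN. Qed.

Lemma eucl0_eq x : eucl x = 0 -> x = 0.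
Proof.
move=> x0; apply/rowP => i; rewrite mxE; apply/eqP; rewrite -normr_le0 -x0.
exact: le_coord_eucl.
Qed.

End euclidean.

(** * The gradient of the potential *)

Section potential_gradient.
Context {R : realType}.
Local Notation mR := (measurableTypeR R).
Local Notation pt := (@Defs.point R _).
Variable k : R -> R.
Hypothesis dk : forall r, 0 < r -> derivable k r 1.

(** The difference quotients at 0 are odd in the increment, so their limit can
only be 0; when they diverge, the derivative takes its default value, also 0. *)
Lemma derive_even_eq0 n (f : 'rV[R]_n -> R) (v : 'rV[R]_n) :
  (forall x, f (- x) = f x) -> 'D_v f 0 = 0.
Proof.
move=> fN.
set q := fun h : R => h^-1 *: (f (h *: v + 0) - f 0).
have qN h : q (- h) = - q h.
  by rewrite /q !addr0 scaleNr fN invrN scaleNr.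
have [/cvg_ex[l ql]|ndq] := pselect (cvg (q h @[h --> 0^'])); last first.
  rewrite /derive /lim /lim_in /get; apply: xgetPN => l /= ql; apply: ndq.
  by apply/cvg_ex; exists l.
rewrite /derive (cvg_lim _ ql)//.
have /cvgr_dnbhsP qs := ql.
pose u m : R := m.+1%:R^-1.
have u0 m : u m != 0 by rewrite invr_eq0.
have uc : u m @[m --> \oo] --> (0 : R) by exact: cvg_harmonic.
have q1 : q (u m) @[m --> \oo] --> l by apply: qs; split.
have q2 : q (- u m) @[m --> \oo] --> l.
  apply: (qs (fun m => - u m)); split; first by move=> m; rewrite oppr_eq0.
  by rewrite -[X in _ --> X]oppr0; exact: cvgN.
have q3 : q (- u m) @[m --> \oo] --> - l.
  under eq_fun do rewrite qN; exact: cvgN.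
have : l = - l by exact: (cvg_unique _ q2 q3).
by move=> ll; apply/eqP; lra.
Qed.

(** The value at the origin is 0, through the convention for division by 0. *)
Definition kernel_grad n (j : 'I_n) (z : 'rV[R]_n) : R :=
  derive1 k (eucl z) * (z ord0 j / eucl z).

(** Away from the origin this is the chain rule along coordinate lines; at the
origin both sides vanish, so that the formula holds without exception. *)
Lemma grad_potentialE n (j : 'I_n) (z : 'rV[R]_n) :
  grad (potential k) z ord0 j = kernel_grad n j z.
Proof.
rewrite /grad mxE /partial /kernel_grad.
have [z0|z0] := eqVneq (eucl z) 0.
  rewrite z0 (eucl0_eq _ z0) invr0 mulr0 mulr0.
  by apply: derive_even_eq0 => x; rewrite /potential euclN.
have A : 0 < eucl z by rewrite lt_neqAle eq_sym z0 eucl_ge0.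
suff d : is_derive z (delta_mx ord0 j : 'rV[R]_n) (potential k) (derive1 k (eucl z) * (z ord0 j / eucl z)).
  exact: derive_val.
apply: is_derive_of_line.
have -> : (fun r : R => potential k (z + r *: delta_mx ord0 j)) =
    k \o (Num.sqrt \o (fun r => nsq n z + 2 * r * z ord0 j + r ^+ 2)).
  by apply/funext => r; rewrite /potential /= euclE nsq_line.
have dN : is_derive (0 : R) 1 (fun r => nsq n z + 2 * r * z ord0 j + r ^+ 2) (2 * z ord0 j).
  apply: (@is_derive_quadratic _ _ _ _ 1) => h.
  rewrite [X in `|X|](_ : _ = h ^+ 2); last by ring.
  by rewrite normrX real_normK ?num_real// mul1r.
have E0 : nsq n z + 2 * 0 * z ord0 j + 0 ^+ 2 = nsq n z.
  by rewrite mulr0 mul0r expr0n /= !addr0.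
have s0 : 0 < nsq n z + 2 * 0 * z ord0 j + 0 ^+ 2.
  by rewrite E0 nsqE exprn_gt0.
have d1 := @is_derive1_comp R Num.sqrt (fun r => nsq n z + 2 * r * z ord0 j + r ^+ 2) _ _ _ (is_derive1_sqrt s0) dN.
have d2 : is_derive ((Num.sqrt \o (fun r => nsq n z + 2 * r * z ord0 j + r ^+ 2)) 0) 1 k (derive1 k (eucl z)).
  rewrite /= E0 -euclE derive1E; apply: DeriveDef => //; exact: dk.
have := @is_derive1_comp R k _ _ _ _ d2 d1.
move=> d3; apply: is_derive_eq d3 _.
rewrite E0 -euclE; congr (_ * _); field.
exact: z0.
Qed.

(** A pointwise limit of difference quotients. *)
Lemma measurable_derive_pos : measurable_fun (`]0, +oo[%classic : set R) (derive1 k).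
Proof.
pose u m : R := m.+1%:R^-1.
have u0 m : 0 < u m by rewrite invr_gt0.
have ck r : 0 < r -> {for r, continuous k}.
  by move=> r0; apply: differentiable_continuous; apply/derivable1_diffP; exact: dk.
have mk c : 0 <= c -> measurable_fun (`]0, +oo[%classic : set R) (fun r => k (r + c)).
  move=> c0; apply: open_continuous_measurable_fun; first exact: interval_open.
  move=> r; rewrite inE /= in_itv /= andbT => r0.
  apply: (@continuous_comp _ _ _ (fun r => r + c) k).
    by apply: cvgD; [exact: cvg_id|exact: cvg_cst].
  by apply: ck; rewrite ltr_wpDr.
apply: (@measurable_fun_cvg _ mR R _ (fun m (r : R) => (u m)^-1 * (k (r + u m) - k (r + 0)))).
  move=> m; apply: measurable_funM; first exact: measurable_cst.
  by apply: measurable_funB; apply: mk; [exact: ltW|exact: lexx].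
move=> r; rewrite /= in_itv /= andbT => r0.
have /cvg_ex[l kl] := dk _ r0.
have -> : derive1 k r = l.
  by rewrite derive1E /derive; apply/cvg_lim.
have /cvgr_dnbhsP /(_ u) := kl.
have uc : (forall m, u m != 0) /\ u m @[m --> \oo] --> (0 : R).
  by split => [m|]; [rewrite gt_eqF|exact: cvg_harmonic].
move=> /(_ uc); apply: cvg_trans; apply: near_eq_cvg; apply: nearW => m.
by rewrite /= addr0 [(u m)%:A]/GRing.scale /= mulr1 (addrC (u m)).
Qed.

Lemma measurable_kernel_grad n (j : 'I_n) : measurable_fun setT
  (fun z : n.-tuple mR * n.-tuple mR => kernel_grad n j (pt z.1 - pt z.2)).
Proof.
pose D : set R := `]0, +oo[%classic.
have mD : measurable D by exact: measurable_itv.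
pose q := (fun r : R => derive1 k r * r^-1) \_ D.
have mkD : measurable_fun setT q.
  apply/(measurable_restrictT _ mD); apply: measurable_funM.
    exact: measurable_derive_pos.
  apply: open_continuous_measurable_fun; first exact: interval_open.
  move=> r; rewrite inE /D /= in_itv /= andbT => r0.
  by apply: cvgV; [rewrite gt_eqF|exact: cvg_id].
have mc (i : 'I_n) : measurable_fun setT
    (fun z : n.-tuple mR * n.-tuple mR => (pt z.1 - pt z.2) ord0 i).
  under eq_fun do rewrite !mxE.
  apply: measurable_funB.
    exact: (measurableT_comp (measurable_tnth i) measurable_fst).
  exact: (measurableT_comp (measurable_tnth i) measurable_snd).
have me : measurable_fun setT
    (fun z : n.-tuple mR * n.-tuple mR => eucl (pt z.1 - pt z.2)).
  rewrite /eucl.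
  apply: (measurableT_comp (f := @Num.sqrt R)).
    by apply: continuous_measurable_fun => x; exact: sqrt_continuous.
  by apply: measurable_sum => i; apply: measurable_funX.
have -> : (fun z : n.-tuple mR * n.-tuple mR => kernel_grad n j (pt z.1 - pt z.2)) =
   (fun z => q (eucl (pt z.1 - pt z.2)) * (pt z.1 - pt z.2) ord0 j).
  apply/funext => z; rewrite /kernel_grad /q patchE.
  case: ifPn => [_|]; first by rewrite mulrA mulrAC.
  rewrite notin_setE /D /= in_itv /= andbT => /negP.
  rewrite -leNgt => e0; have -> : eucl (pt z.1 - pt z.2) = 0.
    by apply/eqP; rewrite eq_le e0 eucl_ge0.
  by rewrite invr0 !mulr0 mul0r.
by apply: measurable_funM => //; exact: (measurableT_comp mkD).
Qed.

End potential_gradient.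

(** * The symmetrized interaction *)

Section pointwise.
Context {R : realType} {n : nat}.
Variables (k : R -> R) (kap L C gam e h : R).
Hypotheses (kap0 : 0 <= kap) (L0 : 0 <= L) (C0 : 0 <= C) (gam0 : 0 <= gam).
Hypotheses (e0 : 0 < e) (e1 : e <= 1) (h0 : 0 < h).
Hypothesis k_le : forall r, 0 < r -> derive1 k r <= - kap + L * r.
Hypothesis k_bound : forall r, 0 < r -> `|derive1 k r| <= C + gam * r.
Implicit Types x y : 'rV[R]_n.

Let dirv x : 'rV[R]_n := \row_j direction n e j x.

Lemma dot_dirv x z : dot (dirv x) z = dot x z / bracket n e x.
Proof. by rewrite /dot mulr_suml; apply: eq_bigr => i _; rewrite mxE /direction mulrAC. Qed.

Lemma eucl_dirv x : eucl (dirv x) <= 1.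
Proof.
have B := bracket_gt0 n e e0 x.
have -> : eucl (dirv x) = eucl x / bracket n e x.
  have S : \sum_i dirv x ord0 i ^+ 2 = (eucl x / bracket n e x) ^+ 2.
    rewrite expr_div_n -nsqE /nsq mulr_suml; apply: eq_bigr => i _.
    by rewrite mxE /direction expr_div_n.
  by rewrite {1}/eucl S sqrtr_sqr ger0_norm// divr_ge0 ?eucl_ge0 ?ltW.
by rewrite ler_pdivrMr// mul1r bracket_ge_eucl.
Qed.

Lemma kernel_gradN j (z : 'rV[R]_n) : kernel_grad k n j (- z) = - kernel_grad k n j z.
Proof. by rewrite /kernel_grad euclN mxE mulNr mulrN. Qed.

Lemma kernel_grad_sum (v : 'I_n -> R) (z : 'rV[R]_n) (V := \row_j v j : 'rV[R]_n) :
  \sum_j v j * kernel_grad k n j z = derive1 k (eucl z) / eucl z * dot V z.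
Proof.
rewrite /dot mulr_sumr; apply: eq_bigr => i _.
by rewrite mxE /kernel_grad; ring.
Qed.

(** Lift x and y to X = (x, e) and Y = (y, e) in one dimension more.  Then |X| and
|Y| are the two brackets, X - Y = (x - y, 0), and the identity becomes
(X/|X| - Y/|Y|) . (X - Y) = (|X| + |Y|) (1 - X/|X| . Y/|Y|). *)
Lemma direction_gap x y (X := bracket n e x) (Y := bracket n e y) :
  dot (dirv x) (x - y) - dot (dirv y) (x - y) =
  (X + Y) * (1 - \sum_j direction n e j x * direction n e j y - e / X * (e / Y)).
Proof.
have X0 : 0 < X by exact: bracket_gt0.
have Y0 : 0 < Y by exact: bracket_gt0.
have -> : \sum_j direction n e j x * direction n e j y = dot x y / (X * Y).
  by rewrite /dot mulr_suml; apply: eq_bigr => i _; rewrite /direction -/X -/Y; field; rewrite !gt_eqF.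
have dxy : dot x (x - y) = X ^+ 2 - e ^+ 2 - dot x y.
  rewrite sqr_bracket// [e ^+ 2 + _]addrC addrK /dot /nsq -sumrB.
  by apply: eq_bigr => i _; rewrite !mxE; ring.
have dyx : dot y (x - y) = dot x y - (Y ^+ 2 - e ^+ 2).
  rewrite sqr_bracket// [e ^+ 2 + _]addrC addrK /dot /nsq -sumrB.
  by apply: eq_bigr => i _; rewrite !mxE; ring.
rewrite !dot_dirv dxy dyx -/X -/Y; field.
by rewrite !gt_eqF.
Qed.

(** In the lifted picture of [direction_gap] this is Cauchy-Schwarz in R^(n+1). *)
Lemma direction_gap_factor_ge0 x y (X := bracket n e x) (Y := bracket n e y) :
  0 <= 1 - \sum_j direction n e j x * direction n e j y - e / X * (e / Y).
Proof.
have X0 : 0 < X by exact: bracket_gt0.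
have Y0 : 0 < Y by exact: bracket_gt0.
have -> : \sum_j direction n e j x * direction n e j y = dot x y / (X * Y).
  by rewrite /dot mulr_suml; apply: eq_bigr => i _; rewrite /direction -/X -/Y; field; rewrite !gt_eqF.
rewrite [X in 0 <= X](_ : _ = (X * Y - (dot x y + e ^+ 2)) / (X * Y)); last first.
  by field; rewrite !gt_eqF.
rewrite divr_ge0 ?mulr_ge0 ?(ltW X0) ?(ltW Y0)// subr_ge0.
have xy := dot_le x y.
have X2 : X ^+ 2 = e ^+ 2 + eucl x ^+ 2 by rewrite sqr_bracket// nsqE.
have Y2 : Y ^+ 2 = e ^+ 2 + eucl y ^+ 2 by rewrite sqr_bracket// nsqE.
apply: (@le_trans _ _ (eucl x * eucl y + e ^+ 2)); first by rewrite lerD2r.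
have a0 := eucl_ge0 n x; have b0 := eucl_ge0 n y.
have P1 : 0 <= X * Y by rewrite mulr_ge0 ?ltW.
have P2 : 0 <= eucl x * eucl y + e ^+ 2 by apply: addr_ge0; [exact: mulr_ge0|exact: sqr_ge0].
rewrite -(ler_pXn2r (ltn0Sn 1)) ?nnegrE//.
rewrite exprMn X2 Y2.
rewrite -subr_ge0 [leRHS](_ : _ = (e * (eucl x - eucl y)) ^+ 2) ?sqr_ge0//.
by ring.
Qed.

(** The pointwise form of the moment inequality.  Let a be the factor of - kap and p
the direction field.  By [direction_gap], (p(x) - p(y)) . (x - y) lies between
a |x - y| and 2 |x - y|.  It is divided by |x - y| and multiplied by
k' <= - kap + L |x - y|: the lower bound serves for - kap, the upper one for L |x - y|.
Replacing Z by 1 costs ((1 - Z(x)) + (1 - Z(y))) |k'|, where the first factor is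
bounded by 4 h (|x| + |y|) against C and by 2 against gam |x - y|. *)
Lemma symmetrized_le x y :
  \sum_j (cutoff n h x * direction n e j x * kernel_grad k n j (x - y)
        + cutoff n h y * direction n e j y * kernel_grad k n j (y - x)) <=
  - kap * (1 - \sum_j direction n e j x * direction n e j y
             - e / bracket n e x * (e / bracket n e y))
  + (2 * L + 4 * h * C + 2 * gam) * (eucl x + eucl y).
Proof.
have [kap0' L0' C0' gam0' h0'] := And5 kap0 L0 C0 gam0 h0.
set a := 1 - _ - _.
have a0 : 0 <= a by exact: direction_gap_factor_ge0.
set r := eucl (x - y).
have yx : y - x = - (x - y) by rewrite opprB.
have -> : \sum_j (cutoff n h x * direction n e j x * kernel_grad k n j (x - y)
        + cutoff n h y * direction n e j y * kernel_grad k n j (y - x)) =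
    derive1 k r / r * (cutoff n h x * dot (dirv x) (x - y) - cutoff n h y * dot (dirv y) (x - y)).
  rewrite mulrBr !(mulrCA _ (cutoff n h _)) -!kernel_grad_sum !mulr_sumr -sumrB.
  by apply: eq_bigr => j _; rewrite yx kernel_gradN; ring.
have gap := direction_gap x y; rewrite -/a in gap.
set al := dot (dirv x) (x - y) in gap *.
set be := dot (dirv y) (x - y) in gap *.
have x0 := eucl_ge0 n x; have y0 := eucl_ge0 n y.
have [r0|r0] := eqVneq r 0.
  have xy : x = y by apply/eqP; rewrite -subr_eq0; apply/eqP; exact: eucl0_eq.
  have a00 : a = 0.
    have : (bracket n e x + bracket n e y) * a = 0.
      by rewrite -gap /al /be xy subrr.
    move/eqP; rewrite mulf_eq0 => /orP[|/eqP //].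
    by rewrite gt_eqF// addr_gt0// bracket_gt0.
  rewrite r0 invr0 mulr0 mul0r a00 mulr0 add0r.
  have hC : 0 <= h * C by apply: mulr_ge0 => //; exact: ltW.
  apply: mulr_ge0; last exact: addr_ge0.
  by lra.
have {}r0 : 0 < r by rewrite lt_neqAle eq_sym r0 eucl_ge0.
have rxy : r <= eucl x + eucl y by rewrite -(euclN y) euclD_le.
have al_le : `|al| <= r.
  by apply: (le_trans (norm_dot_le _ _)); rewrite ler_piMl ?eucl_dirv ?ltW.
have be_le : `|be| <= r.
  by apply: (le_trans (norm_dot_le _ _)); rewrite ler_piMl ?eucl_dirv ?ltW.
have Zx0 := cutoff_ge0 n h x; have Zx1 := cutoff_le1 n h h0 x.
have Zy0 := cutoff_ge0 n h y; have Zy1 := cutoff_le1 n h h0 y.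
have Zx := onem_cutoff_le n h h0 x; have Zy := onem_cutoff_le n h h0 y.
set Z := cutoff n h x in Zx0 Zx1 Zx *; set Z' := cutoff n h y in Zy0 Zy1 Zy *.
have kr1 := k_le _ r0; have kr2 := k_bound _ r0.
set K := derive1 k r in kr1 kr2 *.
have bge : r * a <= al - be.
  rewrite gap ler_wpM2r//.
  by apply: (le_trans rxy); apply: lerD; exact: bracket_ge_eucl.
have ra0 : 0 <= r * a by apply: mulr_ge0 => //; exact: ltW.
have ble : al - be <= 2 * r.
  by move: al_le be_le; rewrite !ler_norml; lra.
(* the inequality for Z = 1; al - be is the geometric factor times r *)
have main : K / r * (al - be) <= - kap * a + 2 * L * r.
  rewrite mulrAC ler_pdivrMr//.
  have : K * (al - be) <= (- kap + L * r) * (al - be) by rewrite ler_wpM2r//; lra.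
  have : kap * (r * a) <= kap * (al - be) by rewrite ler_wpM2l.
  have : L * r * (al - be) <= L * r * (2 * r) by rewrite ler_wpM2l// mulr_ge0// ltW.
  by lra.
have Kr : `|K / r| * r = `|K|.
  by rewrite normrM normfV (gtr0_norm r0) mulfVK// gt_eqF.
(* replacing Z by 1 changes the sum by at most this *)
have tail : - (K / r * ((1 - Z) * al - (1 - Z') * be)) <= (4 * h * C + 2 * gam) * (eucl x + eucl y).
  apply: (le_trans (ler_norm _)); rewrite normrN normrM.
  have N : `|(1 - Z) * al - (1 - Z') * be| <= ((1 - Z) + (1 - Z')) * r.
    apply: (le_trans (ler_normB _ _)); rewrite !normrM [leRHS]mulrDl.
    rewrite (@ger0_norm _ (1 - Z)) ?subr_ge0// (@ger0_norm _ (1 - Z')) ?subr_ge0//.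
    by apply: lerD; rewrite ler_wpM2l// subr_ge0.
  apply: (@le_trans _ _ (`|K / r| * (((1 - Z) + (1 - Z')) * r))); first by rewrite ler_wpM2l.
  rewrite mulrCA Kr.
  have T0 : 0 <= (1 - Z) + (1 - Z') by lra.
  apply: (@le_trans _ _ (((1 - Z) + (1 - Z')) * (C + gam * r))); first by rewrite ler_wpM2l.
  have : ((1 - Z) + (1 - Z')) * C <= (4 * h * eucl x + 4 * h * eucl y) * C by rewrite ler_wpM2r// lerD.
  have : ((1 - Z) + (1 - Z')) * (gam * r) <= 2 * (gam * r) by rewrite ler_wpM2r ?mulr_ge0 ?(ltW r0)//; lra.
  have : gam * r <= gam * (eucl x + eucl y) by rewrite ler_wpM2l.
  by lra.
have Lr : L * r <= L * (eucl x + eucl y) by rewrite ler_wpM2l.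
have -> : K / r * (Z * al - Z' * be) = K / r * (al - be) - K / r * ((1 - Z) * al - (1 - Z') * be).
  by ring.
by lra.
Qed.

End pointwise.

(** * Integrable real functions *)

Section real_integrable.
Context {R : realType} {dT : measure_display} {T : measurableType dT}.
Variable mu : {measure set T -> \bar R}.
Implicit Types f g : T -> R.

Definition rintegrable f := mu.-integrable setT (EFin \o f).

Lemma rintegrable_measurable f : rintegrable f -> measurable_fun setT f.
Proof. by move=> fi; apply/measurable_EFinP; exact: measurable_int fi. Qed.

Lemma rintegrable_D f g : rintegrable f -> rintegrable g -> rintegrable (fun x => f x + g x).
Proof. by move=> fi gi; exact: (integrableD measurableT fi gi). Qed.

Lemma rintegrable_Z c f : rintegrable f -> rintegrable (fun x => c * f x).
Proof. by move=> fi; exact: (integrableZl measurableT c fi). Qed.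

Lemma rintegrable_B f g : rintegrable f -> rintegrable g -> rintegrable (fun x => f x - g x).
Proof. by move=> fi gi; exact: (integrableB measurableT fi gi). Qed.

Lemma rintegrable_0 : rintegrable (fun=> 0).
Proof. exact: (@integrable0 _ _ _ mu setT). Qed.

Lemma rintegrable_sum (I : Type) (s : seq I) (F : I -> T -> R) :
  (forall i, rintegrable (F i)) -> rintegrable (fun x => \sum_(i <- s) F i x).
Proof.
move=> Fi; elim: s => [|i s IH].
  by under eq_fun do rewrite big_nil; exact: rintegrable_0.
by under eq_fun do rewrite big_cons; exact: rintegrable_D.
Qed.

Lemma Rint_D f g : rintegrable f -> rintegrable g ->
  \int[mu]_x (f x + g x) = \int[mu]_x f x + \int[mu]_x g x.
Proof. exact: RintegralD. Qed.

Lemma Rint_B f g : rintegrable f -> rintegrable g ->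
  \int[mu]_x (f x - g x) = \int[mu]_x f x - \int[mu]_x g x.
Proof. exact: RintegralB. Qed.

Lemma Rint_Z c f : rintegrable f -> \int[mu]_x (c * f x) = c * \int[mu]_x f x.
Proof. by move=> fi; rewrite RintegralZl. Qed.

Lemma Rint_sum (I : Type) (s : seq I) (F : I -> T -> R) :
  (forall i, rintegrable (F i)) ->
  \int[mu]_x (\sum_(i <- s) F i x) = \sum_(i <- s) \int[mu]_x F i x.
Proof.
move=> Fi; elim: s => [|i s IH].
  rewrite big_nil; under eq_Rintegral do rewrite big_nil.
  by rewrite /Rintegral integral0.
rewrite big_cons -IH -Rint_D//; last exact: rintegrable_sum.
by apply: eq_Rintegral => x _; rewrite big_cons.
Qed.

Lemma Rint_le f g : rintegrable f -> rintegrable g -> (forall x, f x <= g x) ->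
  \int[mu]_x f x <= \int[mu]_x g x.
Proof. by move=> fi gi fg; apply: le_Rintegral => // x _. Qed.

Lemma rintegrable_dominated f g : measurable_fun setT f -> (forall x, `|f x| <= g x) ->
  rintegrable g -> rintegrable f.
Proof.
move=> mf fg; apply: le_integrable => //; first exact/measurable_EFinP.
by move=> x _; rewrite /= lee_fin (le_trans (fg x))// ler_norm.
Qed.

Lemma rintegrable_abs f : rintegrable f -> rintegrable (fun x => `|f x|).
Proof. exact: integrable_norm. Qed.

Lemma rintegrable_bounded_mul c f g : measurable_fun setT f -> (forall x, `|f x| <= c) ->
  rintegrable g -> rintegrable (fun x => f x * g x).
Proof.
move=> mf fc gi; apply: (@rintegrable_dominated _ (fun x => c * `|g x|)).
- by apply: measurable_funM => //; exact: rintegrable_measurable.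
- by move=> x; rewrite normrM ler_wpM2r.
- by apply: rintegrable_Z; exact: rintegrable_abs.
Qed.

End real_integrable.

(** * The dissipation at a fixed time *)

Section fixed_time.
Context {R : realType} {n : nat}.
Local Notation mR := (measurableTypeR R).
Local Notation pt := (@Defs.point R n).
Variables (k : R -> R) (kap L C gam e h : R) (w : 'rV[R]_n -> R).
Hypotheses (kap0 : 0 <= kap) (L0 : 0 <= L) (C0 : 0 <= C) (gam0 : 0 <= gam).
Hypotheses (e0 : 0 < e) (e1 : e <= 1) (h0 : 0 < h).
Hypothesis dk : forall r, 0 < r -> derivable k r 1.
Hypothesis k_le : forall r, 0 < r -> derive1 k r <= - kap + L * r.
Hypothesis k_bound : forall r, 0 < r -> `|derive1 k r| <= C + gam * r.

Local Notation intw f := (rintegrable (leb n) (fun t => f (pt t))).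
Local Notation Int f := (\int[leb n]_t f (pt t)).

Hypothesis w_cont : continuous w.
Hypothesis w_ge0 : forall x, 0 <= w x.
Hypothesis w_even : forall x, w (- x) = w x.
Hypothesis w_int : intw w.
Hypothesis w_mom : intw (fun x => eucl x * w x).
Hypothesis w_conv : forall x j, intw (fun y => grad (potential k) (x - y) ord0 j * w y).
Hypothesis w_flux : forall j, intw (fun x => flux k w x ord0 j).

Let M := Int w.
Let m := Int (fun x => eucl x * w x).
Let E := Int (fun x => e / bracket n e x * w x).

Lemma measurable_pt (f : 'rV[R]_n -> R) : continuous f ->
  measurable_fun setT (fun t : n.-tuple mR => f (pt t)).
Proof. exact: measurable_point_comp. Qed.

Lemma Int_direction0 j : Int (fun x => direction n e j x * w x) = 0.
Proof.
rewrite /Rintegral (integral_odd0 n (fun t => direction n e j (pt t) * w (pt t)))//.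
  apply: (rintegrable_bounded_mul _ 1 (fun t => direction n e j (pt t)) (fun t => w (pt t))) => //.
    by apply: measurable_pt; exact: continuous_direction.
  by move=> x; exact: direction_le1.
move=> t; have -> : pt (tuple_opp n t) = - pt t.
  by apply/rowP => i; rewrite !mxE tnth_mktuple.
by rewrite directionN w_even mulNr.
Qed.

Let H j (z : n.-tuple mR * n.-tuple mR) : R :=
  cutoff n h (pt z.1) * direction n e j (pt z.1) * w (pt z.1) *
  (kernel_grad k n j (pt z.1 - pt z.2) * w (pt z.2)).

Local Notation P := (@leb R n \x @leb R n)%E.

Lemma kernel_grad_bound j (z : 'rV[R]_n) : `|kernel_grad k n j z| <= C + gam * eucl z.
Proof.
rewrite /kernel_grad; have [z0|z0] := eqVneq (eucl z) 0.
  by rewrite z0 invr0 !mulr0 normr0 addr0.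
have A : 0 < eucl z by rewrite lt_neqAle eq_sym z0 eucl_ge0.
rewrite normrM; apply: le_trans (k_bound _ A).
rewrite ler_piMr// normrM normfV (gtr0_norm A) ler_pdivrMr// mul1r.
exact: le_coord_eucl.
Qed.

Let w2 : rintegrable P (fun z => w (pt z.1) * w (pt z.2)).
Proof. exact: (integrable_separable (fun t => w (pt t)) (fun t => w (pt t))). Qed.

Let wm1 : rintegrable P (fun z => (eucl (pt z.1) * w (pt z.1)) * w (pt z.2)).
Proof. exact: (integrable_separable (fun t => eucl (pt t) * w (pt t)) (fun t => w (pt t))). Qed.

Let wm2 : rintegrable P (fun z => w (pt z.1) * (eucl (pt z.2) * w (pt z.2))).
Proof. exact: (integrable_separable (fun t => w (pt t)) (fun t => eucl (pt t) * w (pt t))). Qed.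

Lemma cutoff_direction_le j x : `|cutoff n h x * direction n e j x| <= 1.
Proof.
rewrite normrM (ger0_norm (cutoff_ge0 _ _ _)) mulr_ile1 ?cutoff_ge0 ?cutoff_le1//.
exact: direction_le1.
Qed.

Lemma measurable_comp1 (f : 'rV[R]_n -> R) : continuous f ->
  measurable_fun setT (fun z : n.-tuple mR * n.-tuple mR => f (pt z.1)).
Proof. by move=> cf; exact: (measurableT_comp (measurable_pt _ cf) measurable_fst). Qed.

Lemma measurable_comp2 (f : 'rV[R]_n -> R) : continuous f ->
  measurable_fun setT (fun z : n.-tuple mR * n.-tuple mR => f (pt z.2)).
Proof. by move=> cf; exact: (measurableT_comp (measurable_pt _ cf) measurable_snd). Qed.

Lemma pair_flux_integrable j : rintegrable P (H j).
Proof.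
apply: (@rintegrable_dominated _ _ _ _ _ (fun z => C * (w (pt z.1) * w (pt z.2)) +
    gam * (eucl (pt z.1) * w (pt z.1) * w (pt z.2) + w (pt z.1) * (eucl (pt z.2) * w (pt z.2))))).
- apply: measurable_funM.
    apply: measurable_funM; last exact: measurable_comp1.
    apply: measurable_funM; apply: measurable_comp1; first exact: continuous_cutoff.
    exact: continuous_direction.
  apply: measurable_funM; last exact: measurable_comp2.
  exact: measurable_kernel_grad.
- move=> z; rewrite /H; set x := pt z.1; set y := pt z.2.
  rewrite normrM (normrM _ (w x)) (normrM _ (w y)) (ger0_norm (w_ge0 x)) (ger0_norm (w_ge0 y)).
  have a1 := cutoff_direction_le j x.
  have kb := kernel_grad_bound j (x - y).
  have tri : eucl (x - y) <= eucl x + eucl y by rewrite -(euclN y) euclD_le.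
  have gt := ler_wpM2l gam0 tri.
  have ww : 0 <= w x * w y by rewrite mulr_ge0.
  set a := `|cutoff n h x * _| in a1 *; set b := `|kernel_grad _ _ _ _| in kb *.
  have ab : a * b <= C + gam * (eucl x + eucl y).
    apply: (@le_trans _ _ b); first by rewrite ler_piMl// normr_ge0.
    by apply: (le_trans kb); rewrite lerD2l.
  have := ler_wpM2r ww ab; rewrite -/a -/b => abw.
  rewrite [leLHS](_ : _ = a * b * (w x * w y)); last by ring.
  by apply: (le_trans abw); rewrite le_eqVlt; apply/orP; left; apply/eqP; ring.
- by apply: rintegrable_D; apply: rintegrable_Z => //; exact: rintegrable_D.
Qed.

(** Fubini: the left-hand side is an iterated integral, in which the inner one is
the convolution that defines the velocity. *)
Lemma Int_cutoff_flux j :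
  Int (fun x => cutoff n h x * direction n e j x * flux k w x ord0 j) = \int[P]_z H j z.
Proof.
rewrite [RHS]/Rintegral -(integral12_prod_meas1 (pair_flux_integrable j)).
rewrite /Rintegral; congr fine; apply: eq_integral => t _; rewrite /fubini_F.
set x := pt t.
have iy : intw (fun y => kernel_grad k n j (x - y) * w y).
  have := w_conv x j; rewrite /rintegrable.
  by under eq_fun do rewrite /= grad_potentialE//.
rewrite -(fineK (integrable_fin_num _ (rintegrable_Z _ (cutoff n h x * direction n e j x * w x) _ iy)))//.
congr EFin; rewrite -/(Rintegral _ _ _) Rint_Z// /flux !mxE mulrA; congr (_ * _).
by apply: eq_Rintegral => s _; rewrite grad_potentialE.
Qed.

(** Exchanging the variables and adding doubles the left-hand side and makes
[symmetrized_le] applicable.  The bound is a sum of products of a function of x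
and a function of y; evenness removes the term with the directions. *)
Lemma sum_Int_cutoff_flux_le :
  \sum_j Int (fun x => cutoff n h x * direction n e j x * flux k w x ord0 j) <=
  - (kap / 2) * (M ^+ 2 - E ^+ 2) + (2 * L + 4 * h * C + 2 * gam) * (M * m).
Proof.
under eq_bigr do rewrite Int_cutoff_flux.
have Hi j := pair_flux_integrable j.
have Hsi j : rintegrable P (fun z => H j (z.2, z.1)) by exact: (integrable_swap (H j) (Hi j)).
have dbl : 2 * \sum_j \int[P]_z H j z = \int[P]_z \sum_j (H j z + H j (z.2, z.1)).
  rewrite Rint_sum; last by move=> j; exact: rintegrable_D.
  rewrite mulr_sumr; apply: eq_bigr => j _.
  rewrite Rint_D// (Rintegral_swap (H j) (Hi j)). by ring.
pose D j (t : n.-tuple mR) := direction n e j (pt t) * w (pt t).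
pose G (t : n.-tuple mR) := e / bracket n e (pt t) * w (pt t).
have Di j : rintegrable (leb n) (D j).
  apply: (rintegrable_bounded_mul _ 1 (fun t => direction n e j (pt t)) (fun t => w (pt t))) => //.
    by apply: measurable_pt; exact: continuous_direction.
  by move=> x; exact: direction_le1.
have Gi : rintegrable (leb n) G.
  apply: (rintegrable_bounded_mul _ 1 (fun t => e / bracket n e (pt t)) (fun t => w (pt t))) => //.
    apply: (measurable_pt (fun x => e / bracket n e x)); apply: continuous_mul; first exact: continuous_const.
    apply: continuous_inv; last exact: continuous_bracket.
    by move=> x; rewrite gt_eqF// bracket_gt0.
  move=> t; have b0 := bracket_gt0 n e e0 (pt t).
  rewrite (@ger0_norm _ (e / _)); last by apply: divr_ge0; exact: ltW.
  rewrite ler_pdivrMr// mul1r -[leLHS](gtr0_norm e0) -sqrtr_sqr.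
  by rewrite ler_wsqrtr// lerDl nsq_ge0.
pose B (z : n.-tuple mR * n.-tuple mR) : R :=
  - kap * (w (pt z.1) * w (pt z.2) - \sum_j D j z.1 * D j z.2 - G z.1 * G z.2) +
  (2 * L + 4 * h * C + 2 * gam) * (eucl (pt z.1) * w (pt z.1) * w (pt z.2) + w (pt z.1) * (eucl (pt z.2) * w (pt z.2))).
have DDi : rintegrable P (fun z => \sum_j D j z.1 * D j z.2).
  by apply: rintegrable_sum => j; exact: (integrable_separable (D j) (D j) (Di j) (Di j)).
have GGi : rintegrable P (fun z => G z.1 * G z.2) by exact: (integrable_separable G G Gi Gi).
have B1 : rintegrable P (fun z => w (pt z.1) * w (pt z.2) - \sum_j D j z.1 * D j z.2 - G z.1 * G z.2).
  by apply: rintegrable_B => //; exact: rintegrable_B.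
have B2 : rintegrable P (fun z => eucl (pt z.1) * w (pt z.1) * w (pt z.2) + w (pt z.1) * (eucl (pt z.2) * w (pt z.2))).
  exact: rintegrable_D.
have Bi : rintegrable P B by apply: rintegrable_D; exact: rintegrable_Z.
have IB : \int[P]_z B z = - kap * (M ^+ 2 - E ^+ 2) + (2 * L + 4 * h * C + 2 * gam) * (2 * (M * m)).
  rewrite /B Rint_D; [|exact: rintegrable_Z..].
  rewrite Rint_Z// Rint_Z// Rint_B//; last exact: rintegrable_B.
  rewrite Rint_B// Rint_D//.
  rewrite Rint_sum; last by move=> j; exact: (integrable_separable (D j) (D j) (Di j) (Di j)).
  rewrite (Rintegral_separable (fun t => w (pt t)) (fun t => w (pt t)))//.
  rewrite (Rintegral_separable G G Gi Gi).
  rewrite (Rintegral_separable (fun t => eucl (pt t) * w (pt t)) (fun t => w (pt t)))//.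
  rewrite (Rintegral_separable (fun t => w (pt t)) (fun t => eucl (pt t) * w (pt t)))//.
  rewrite big1; last first.
    by move=> j _; rewrite (Rintegral_separable (D j) (D j) (Di j) (Di j)) Int_direction0 mul0r.
  by rewrite -/M -/m -/E; ring.
suff : \int[P]_z \sum_j (H j z + H j (z.2, z.1)) <= \int[P]_z B z.
  by rewrite -dbl IB; lra.
apply: Rint_le => //; first by apply: rintegrable_sum => j; exact: rintegrable_D.
move=> z; rewrite /H /B /D /G; set x := pt z.1; set y := pt z.2.
have ww : 0 <= w x * w y by rewrite mulr_ge0.
have := ler_wpM2r ww (symmetrized_le k kap L C gam e h kap0 L0 C0 gam0 e0 h0 k_le k_bound x y).
congr (_ <= _).
  by rewrite mulr_suml; apply: eq_bigr => j _; rewrite /=; ring.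
have -> : \sum_j direction n e j x * w x * (direction n e j y * w y) =
    (\sum_j direction n e j x * direction n e j y) * (w x * w y).
  by rewrite mulr_suml; apply: eq_bigr => j _; ring.
by ring.
Qed.

Lemma sum_Int_test_grad_flux_le :
  \sum_j Int (fun x => test_grad n e h j x * flux k w x ord0 j) <=
  - (kap / 2) * (M ^+ 2 - E ^+ 2) + (2 * L + 4 * h * C + 2 * gam) * (M * m) +
  4 * h * \sum_j Int (fun x => `|flux k w x ord0 j|).
Proof.
have ci j : intw (fun x => cutoff n h x * direction n e j x * flux k w x ord0 j).
  apply: (rintegrable_bounded_mul _ 1 (fun t => cutoff n h (pt t) * direction n e j (pt t)) (fun t => flux k w (pt t) ord0 j)) => //.
    by apply: (measurable_pt (fun x => cutoff n h x * direction n e j x)); apply: continuous_mul; [exact: continuous_cutoff|exact: continuous_direction].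
  by move=> x; exact: cutoff_direction_le.
have di j : intw (fun x => test_grad n e h j x * flux k w x ord0 j).
  apply: (rintegrable_bounded_mul _ (1 + 4 * h) (fun t => test_grad n e h j (pt t)) (fun t => flux k w (pt t) ord0 j)) => //.
    by apply: measurable_pt; exact: continuous_test_grad.
  by move=> x; exact: test_grad_le.
apply: le_trans (lerD sum_Int_cutoff_flux_le (lexx _)).
rewrite mulr_sumr -big_split /=; apply: ler_sum => j _.
have ai := rintegrable_abs _ _ (w_flux j).
rewrite -Rint_Z// -Rint_D//; last exact: rintegrable_Z.
apply: Rint_le => //; first by apply: rintegrable_D => //; exact: rintegrable_Z.
move=> t; rewrite /test_grad mulrDl lerD2l.
apply: (le_trans (ler_norm _)); rewrite normrM ler_wpM2r//.
exact: cutoff_err_le.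
Qed.

End fixed_time.

(** * Evolution of the test moments *)

Lemma continuous_pair_const {U V : topologicalType} (t : U) : continuous (fun x : V => (t, x)).
Proof. by move=> x; apply: cvg_pair; [exact: cvg_cst|exact: cvg_id]. Qed.

Section joint_continuity.
Context {R : realType} {n : nat}.
Variables (T : R) (g : R -> 'rV[R]_n -> R).
Hypothesis gc : jointly_continuous_on T g.

Lemma jointly_continuous_slice t : 0 < t < T -> continuous (g t).
Proof.
move=> tT x.
apply: (@continuous_comp _ _ _ (fun x : 'rV[R]_n => (t, x)) (fun p : R * 'rV[R]_n => g p.1 p.2)); last exact: gc.
exact: continuous_pair_const.
Qed.

Lemma jointly_continuous_bounded (lo hi a : R) : 0 < lo -> hi < T ->
  exists2 C, 0 <= C & forall t x, lo <= t <= hi -> `|x| <= a -> `|g t x| <= C.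
Proof.
move=> lo0 hiT.
pose K : set (R * 'rV[R]_n) :=
  `[lo, hi]%classic `*` [set x : 'rV[R]_n | forall i, (`[- a, a]%classic : set R) (x ord0 i)].
have cK : compact K.
  by apply: compact_setX; [exact: segment_compact|exact: compact_ball_norm].
have gK : {within K, continuous (fun p : R * 'rV[R]_n => g p.1 p.2)}.
  apply: continuous_in_subspaceT => -[t x]; rewrite inE => -[/= + _].
  rewrite in_itv /= => tl; apply: gc.
  by lra.
have [N [Nr]] := compact_bounded (continuous_compact gK cK).
move=> /(_ (`|N| + 1)) NB; exists (`|N| + 1); first by rewrite addr_ge0.
move=> t x tl xa; apply: NB; first by have := ler_norm N; lra.
exists (t, x) => //; split; first by rewrite /= in_itv.
move=> i; rewrite /= in_itv /= -ler_norml (le_trans _ xa)//.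
exact: le_coord_norm.
Qed.

End joint_continuity.

Section solution_evolution.
Context {R : realType} {n : nat}.
Local Notation mR := (measurableTypeR R).
Local Notation pt := (@Defs.point R n).
Local Notation intw f := (rintegrable (leb n) (fun t => f (pt t))).
Local Notation Int f := (\int[leb n]_t f (pt t)).
Variables (k : R -> R) (u0 : 'rV[R]_n -> R) (T : R) (u : R -> 'rV[R]_n -> R).
Hypothesis S : solution k u0 T u.
Variables (e h : R).
Hypotheses (e0 : 0 < e) (e1 : e <= 1) (h0 : 0 < h).

Local Notation F t j := (fun x => flux k (u t) x ord0 j).

Let a := expR h^-1.

Lemma sol_continuous t : 0 < t < T -> continuous (u t).
Proof. exact: (jointly_continuous_slice _ _ (sol_cont S)). Qed.

Lemma flux_continuous t j : 0 < t < T -> continuous (F t j).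
Proof. by move=> tT; exact: (jointly_continuous_slice _ _ (@sol_flux_cont _ _ _ _ _ _ S j) t tT). Qed.

Lemma test_flux_by_parts t j : 0 < t < T ->
  Int (fun x => test_fun n e h x * partial j (F t j) x) = - Int (fun x => test_grad n e h j x * flux k (u t) x ord0 j).
Proof.
move=> tT.
have cF := flux_continuous t j tT.
have cdF : continuous (partial j (F t j)).
  exact: (jointly_continuous_slice _ _ (@sol_flux_dx_cont _ _ _ _ _ _ S j) t tT).
have ct := continuous_test n e h.
have cdt := continuous_test_grad n e h e0 j.
have i1 : intw (fun x => test_fun n e h x * partial j (F t j) x).
  apply: (integrable_compact_support _ (fun x => test_fun n e h x * partial j (F t j) x) a).
    exact: continuous_mul.
  by move=> x xa; rewrite test_support// mul0r.
have i2 : intw (fun x => test_grad n e h j x * flux k (u t) x ord0 j).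
  apply: (integrable_compact_support _ (fun x => test_grad n e h j x * flux k (u t) x ord0 j) a).
    exact: continuous_mul.
  by move=> x xa; rewrite test_grad_support// mul0r.
apply/eqP; rewrite -addr_eq0 -Rint_D//; apply/eqP.
rewrite /Rintegral.
have -> : (\int[leb n]_t0 (test_fun n e h (pt t0) * partial j (F t j) (pt t0) + test_grad n e h j (pt t0) * flux k (u t) (pt t0) ord0 j)%:E = 0)%E; last by [].
apply: (integral_partial_compact n j (fun x => test_fun n e h x * flux k (u t) x ord0 j)
  (fun x => test_fun n e h x * partial j (F t j) x + test_grad n e h j x * flux k (u t) x ord0 j) a).
- move=> x; have d1 := is_derive_test n e h e0 j x.
  have d2 : is_derive x (delta_mx ord0 j : 'rV[R]_n) (F t j) (partial j (F t j) x).
    by apply: DeriveDef => //; exact: (sol_flux_dx S).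
  apply: is_derive_eq (is_deriveM d1 d2) _.
  by rewrite /GRing.scale /=; ring.
- by apply: continuous_add; exact: continuous_mul.
- by move=> x xa; rewrite test_support// test_grad_support// !mul0r addr0.
Qed.

Lemma test_integrable t : 0 < t < T -> intw (fun x => test_fun n e h x * u t x).
Proof.
move=> tT; apply: (integrable_compact_support _ (fun x => test_fun n e h x * u t x) a).
  by apply: continuous_mul; [exact: continuous_test|exact: sol_continuous].
by move=> x xa; rewrite test_support// mul0r.
Qed.

(** Differentiation under the integral, dominated by the supremum of the continuous
function psi d_t u over a compact set, followed by the equation and an
integration by parts. *)
Lemma is_derive_Int_test t : 0 < t < T ->
  is_derive t 1 (fun s => Int (fun x => test_fun n e h x * u s x))
    (\sum_j Int (fun x => test_grad n e h j x * flux k (u t) x ord0 j)).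
Proof.
move=> /andP[t0 tT].
pose lo := t / 2; pose hi := (t + T) / 2.
have lo0 : 0 < lo by rewrite /lo; lra.
have hiT : hi < T by rewrite /hi; lra.
have It : `]lo, hi[%classic t by rewrite /= in_itv /= /lo /hi; lra.
have IT s : `]lo, hi[%classic s -> 0 < s < T by rewrite /= in_itv /=; lra.
have [C C0 HC] := jointly_continuous_bounded _ _ (sol_dt_cont S) lo hi a lo0 hiT.
have [B B0 HB] := continuous_compact_support_bounded n _ a (continuous_test n e h) (test_support n e h h0).
pose G (y : n.-tuple mR) := B * C * \1_(box n a) y.
have G0 y : 0 <= G y by rewrite mulr_ge0 ?mulr_ge0.
have iG : rintegrable (leb n) G.
  apply: rintegrable_Z; apply/integrableP; split.
    by apply/measurable_EFinP; apply: measurable_indic; exact: measurable_box_sym.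
  under eq_integral do rewrite gee0_abs ?lee_fin//.
  by rewrite integral_indic ?setIT; [exact: leb_box_lty|exact: measurableT|exact: measurable_box_sym].
pose f (s : R) (y : n.-tuple mR) := test_fun n e h (pt y) * u s (pt y).
have dfE s y : `]lo, hi[%classic s -> is_derive s 1 (f^~ y) (test_fun n e h (pt y) * derive1 (u^~ (pt y)) s).
  move=> /IT sT.
  have d : is_derive s 1 (u^~ (pt y)) (derive1 (u^~ (pt y)) s).
    by rewrite derive1E; apply: DeriveDef => //; exact: (sol_dt S).
  exact: (is_deriveZ (test_fun n e h (pt y)) d).
have intf s : `]lo, hi[%classic s -> (leb n).-integrable setT (EFin \o f s).
  by move=> /IT; exact: test_integrable.
have derf s y : `]lo, hi[%classic s -> setT y -> derivable (f^~ y) s 1.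
  by move=> /dfE => /(_ y) [].
have ub s y : `]lo, hi[%classic s -> setT y -> `|partial1of2 f s y| <= G y.
  move=> sI _; rewrite /partial1of2 derive1E; have -> := @derive_val _ _ _ _ _ _ _ (dfE s y sI).
  rewrite /G normrM; have [ya|ya] := leP `|pt y| a; last first.
    by rewrite test_support// normr0 mul0r mulr_ge0// mulr_ge0.
  rewrite indicE mem_set ?mulr1; last exact: point_in_box.
  apply: ler_pM => //; apply: HC => //.
  by move: sI; rewrite /= in_itv /=; lra.
have D := derivable_under_integral measurableT It intf derf G0 iG ub.
apply: DeriveDef => //.
rewrite -derive1E (differentiation_under_integral measurableT It intf derf G0 iG ub).
have tT' : 0 < t < T by rewrite t0.
have cdF j : continuous (partial j (F t j)).
  exact: (jointly_continuous_slice _ _ (@sol_flux_dx_cont _ _ _ _ _ _ S j) t tT').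
transitivity (Int (fun x => \sum_j - 1 * (test_fun n e h x * partial j (F t j) x))).
  apply: eq_Rintegral => y _; rewrite /partial1of2 derive1E.
  have -> := @derive_val _ _ _ _ _ _ _ (dfE t y It).
  have := @sol_eq _ _ _ _ _ _ S t (pt y) tT'; rewrite /div => /eqP; rewrite addr_eq0 => /eqP ->.
  by rewrite mulrN mulr_sumr -sumrN; apply: eq_bigr => j _; rewrite mulN1r.
have i1 j : intw (fun x => test_fun n e h x * partial j (F t j) x).
  apply: (integrable_compact_support _ (fun x => test_fun n e h x * partial j (F t j) x) a).
    exact: (continuous_mul _ _ (continuous_test n e h) (cdF j)).
  by move=> x xa; rewrite test_support// mul0r.
rewrite Rint_sum; last by move=> j; exact: rintegrable_Z.
by apply: eq_bigr => j _; rewrite Rint_Z// test_flux_by_parts// mulN1r opprK.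
Qed.

Lemma Int_test_increment c s t : 0 < s -> s <= t -> t < T ->
  (forall r, s <= r <= t -> \sum_j Int (fun x => test_grad n e h j x * flux k (u r) x ord0 j) <= c) ->
  Int (fun x => test_fun n e h x * u t x) <= Int (fun x => test_fun n e h x * u s x) + c * (t - s).
Proof.
move=> s0 st tT Hc.
pose f r := Int (fun x => test_fun n e h x * u r x).
pose f' r := \sum_j Int (fun x => test_grad n e h j x * flux k (u r) x ord0 j).
have df r : r \in `[s, t] -> is_derive r 1 f (f' r).
  by rewrite in_itv /= => rI; apply: is_derive_Int_test; lra.
have cf : {within `[s, t], continuous f}.
  apply: derivable_within_continuous => r rI; by case: (df r rI).
have df' r : r \in `]s, t[ -> is_derive r 1 f (f' r).
  by move=> rI; apply: df; exact: subset_itv_oo_cc rI.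
have [r rI E] := MVT_segment st df' cf.
have : f' r * (t - s) <= c * (t - s).
  by rewrite ler_wpM2r ?subr_ge0//; apply: Hc; move: rI; rewrite in_itv.
by rewrite -E; rewrite -/(f t) -/(f s); lra.
Qed.

End solution_evolution.

(** * A priori bounds on the moment *)

Section moment_limit.
Context {R : realType} {n : nat}.
Local Notation mR := (measurableTypeR R).
Local Notation pt := (@Defs.point R n).
Local Notation intw f := (rintegrable (leb n) (fun t => f (pt t))).
Local Notation Int f := (\int[leb n]_t f (pt t)).
Variables (e : R).

Lemma cutoff_decreasing (h1 h2 : R) (x : 'rV[R]_n) : h1 <= h2 -> cutoff n h2 x <= cutoff n h1 x.
Proof.
move=> h12; have l0 := ln_nsq_ge0 n x.
have hl : h1 * ln (1 + nsq n x) <= h2 * ln (1 + nsq n x) by rewrite ler_wpM2r.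
rewrite /cutoff ler_pXn2r ?nnegrE ?pos_cut_ge0//.
by rewrite le_max2//; lra.
Qed.

Lemma test_mul_integrable h (v : 'rV[R]_n -> R) : 0 < h -> intw v ->
  intw (fun x => test_fun n e h x * v x).
Proof.
move=> h0 vi.
have [B _ HB] := continuous_compact_support_bounded n _ _ (continuous_test n e h) (test_support n e h h0).
apply: (rintegrable_bounded_mul _ B (fun t => test_fun n e h (pt t)) (fun t => v (pt t))) => //.
by apply: measurable_point_comp; exact: continuous_test.
Qed.

(** Monotone convergence along h = h1 / (m + 1). *)
Lemma bracket_moment_le (v : 'rV[R]_n -> R) (B h1 : R) : 0 < h1 ->
  (forall x, 0 <= v x) -> intw v ->
  (forall h, 0 < h <= h1 -> Int (fun x => test_fun n e h x * v x) <= B) ->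
  intw (fun x => bracket n e x * v x) /\ Int (fun x => bracket n e x * v x) <= B.
Proof.
move=> h10 v0 vi HB.
pose hn m : R := h1 * m.+1%:R^-1.
have hn0 m : 0 < hn m by rewrite mulr_gt0 ?invr_gt0.
have hn1 m : hn m <= h1.
  by rewrite ler_piMr ?(ltW h10)// invf_le1// ler1n.
pose g m (t : n.-tuple mR) := (test_fun n e (hn m) (pt t) * v (pt t))%:E.
have mb : measurable_fun setT (fun t : n.-tuple mR => bracket n e (pt t) * v (pt t)).
  apply: measurable_funM; last exact: rintegrable_measurable vi.
  by apply: measurable_point_comp; exact: continuous_bracket.
have mg m : measurable_fun setT (g m).
  by apply/measurable_EFinP; apply: rintegrable_measurable; exact: (test_mul_integrable _ _ (hn0 m) vi).
have g0 m t : setT t -> (0 <= g m t)%E by move=> _; rewrite lee_fin mulr_ge0// test_ge0.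
have gnd t : setT t -> {homo g^~ t : m m' / (m <= m')%N >-> (m <= m')%E}.
  move=> _ m m' mm'; rewrite lee_fin ler_wpM2r// ler_wpM2l ?sqrtr_ge0//.
  apply: cutoff_decreasing; rewrite ler_wpM2l ?(ltW h10)//.
  by rewrite lef_pV2 ?posrE// ler_nat.
have glim t : limn (g^~ t) = (bracket n e (pt t) * v (pt t))%:E.
  apply/cvg_lim => //; apply/fine_cvgP; split; first exact: nearW.
  have hl : hn m @[m --> \oo] --> h1 * 0 by apply: cvgMl_tmp; exact: cvg_harmonic.
  set x := pt t.
  have cc : cutoff n (hn m) x @[m --> \oo] --> (1 : R).
    apply: (@squeeze_cvgr _ _ _ _ (fun m => 1 - 4 * hn m * eucl x) (fun=> 1)).
    - apply: nearW => m; rewrite cutoff_le1// andbT.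
      by have := onem_cutoff_le n (hn m) (hn0 m) x; lra.
    - have h4 : (1 - 4 * hn m * eucl x) @[m --> \oo] --> 1 - 4 * (h1 * 0) * eucl x.
        apply: cvgB; first exact: cvg_cst.
        by apply: cvgM; [apply: cvgM; [exact: cvg_cst|exact: hl]|exact: cvg_cst].
      by move: h4; rewrite !(mulr0, mul0r) subr0.
    - exact: cvg_cst.
  rewrite (_ : _ \o _ = (fun m => bracket n e x * cutoff n (hn m) x * v x)); last by [].
  have h5 : bracket n e x * cutoff n (hn m) x * v x @[m --> \oo] --> bracket n e x * 1 * v x.
    by apply: cvgM; [apply: cvgM; [exact: cvg_cst|exact: cc]|exact: cvg_cst].
  by move: h5; rewrite mulr1.
have gc : ((\int[leb n]_t g m t)%E @[m --> \oo] -->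
    (\int[leb n]_t (bracket n e (pt t) * v (pt t))%:E)%E).
  rewrite (eq_integral (fun t => limn (g^~ t))); last by move=> t _; rewrite glim.
  exact: (cvg_monotone_convergence measurableT mg g0 gnd).
have le : (\int[leb n]_t (bracket n e (pt t) * v (pt t))%:E <= B%:E)%E.
  apply: (cvge_to_le gc); apply: nearW => m.
  have ti := test_mul_integrable _ _ (hn0 m) vi.
  rewrite /g -(fineK (integrable_fin_num _ ti))// lee_fin.
  by apply: HB; rewrite hn0 hn1.
have b0 t : (0 <= (bracket n e (pt t) * v (pt t))%:E)%E.
  by rewrite lee_fin; apply: mulr_ge0 => //; exact: sqrtr_ge0.
have bi : intw (fun x => bracket n e x * v x).
  apply/integrableP; split; first exact/measurable_EFinP.
  under eq_integral do rewrite (gee0_abs (b0 _)).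
  by apply: (le_lt_trans le); exact: ltry.
split => //; rewrite -lee_fin /Rintegral fineK//; exact: (integrable_fin_num _ bi).
Qed.

End moment_limit.

Section apriori.
Context {R : realType} {n : nat}.
Local Notation mR := (measurableTypeR R).
Local Notation pt := (@Defs.point R n).
Local Notation intw f := (rintegrable (leb n) (fun t => f (pt t))).
Local Notation Int f := (\int[leb n]_t f (pt t)).
Variables (k : R -> R) (u0 : 'rV[R]_n -> R) (T : R) (u : R -> 'rV[R]_n -> R).
Hypothesis D : initial_datum u0.
Hypothesis S : solution k u0 T u.
Local Notation M := (Int u0).
Local Notation mom e t := (Int (fun x => bracket n e x * u t x)).

Lemma sol_integrable t : 0 < t < T -> intw (u t) /\ Int (u t) = M.
Proof.
move=> tT.
have mass := sol_mass S tT.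
have Mi : (leb n).-integrable setT (fun t => (u0 (pt t))%:E) := datum_integrable D.
have E : (\int[leb n]_s (u t (pt s))%:E = \int[leb n]_s (u0 (pt s))%:E)%E := mass.
split; last by rewrite /Rintegral E.
apply/integrableP; split.
  by apply/measurable_EFinP; apply: measurable_point_comp; exact: (sol_continuous _ _ _ _ S).
under eq_integral do rewrite gee0_abs ?lee_fin ?(sol_ge0 S)//.
by rewrite E; exact: (integrable_lty _ Mi).
Qed.

Lemma mom_integrable_eucl e t : 0 < e -> 0 < t < T ->
  intw (fun x => bracket n e x * u t x) ->
  intw (fun x => eucl x * u t x) /\ Int (fun x => eucl x * u t x) <= mom e t.
Proof.
move=> e0 tT bi.
have le s : eucl (pt s) * u t (pt s) <= bracket n e (pt s) * u t (pt s).
  by rewrite ler_wpM2r ?(sol_ge0 S)// bracket_ge_eucl.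
have ei : intw (fun x => eucl x * u t x).
  apply: (rintegrable_dominated _ _ _ _ _ bi) => [|s].
    apply: measurable_funM; last exact: (rintegrable_measurable _ _ (proj1 (sol_integrable _ tT))).
    by apply: measurable_point_comp; apply: continuous_compose; [exact: continuous_nsq|move=> x; exact: sqrt_continuous].
  by rewrite ger0_norm// mulr_ge0 ?eucl_ge0 ?(sol_ge0 S).
by split => //; exact: Rint_le.
Qed.

(** The single bound on the flux up to time T' on which the crude estimates rest. *)
Lemma flux_bound T' : T' < T -> exists2 A, 0 <= A & forall t, 0 < t <= T' ->
  (forall j, intw (fun x => flux k (u t) x ord0 j)) /\
  \sum_j Int (fun x => `|flux k (u t) x ord0 j|) <= A.
Proof.
move=> T'T; have [C HC] := sol_flux_L1 S T'T.
exists (\sum_(j < n) `|C|); first by apply: sumr_ge0.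
move=> t tT'.
have tT : 0 < t < T by lra.
have mf j : measurable_fun setT (fun s : n.-tuple mR => flux k (u t) (pt s) ord0 j).
  by apply: (measurable_point_comp n (fun x => flux k (u t) x ord0 j)); exact: (flux_continuous _ _ _ _ S t j tT).
have fi j : intw (fun x => flux k (u t) x ord0 j).
  apply/integrableP; split; first exact/measurable_EFinP.
  exact: (le_lt_trans (HC t j tT') (ltry _)).
split => //; apply: ler_sum => j _; apply: le_trans (ler_norm C).
rewrite -lee_fin /Rintegral fineK; first exact: HC.
exact: (integrable_fin_num _ (rintegrable_abs _ _ (fi j))).
Qed.

Lemma test_grad_flux_le e h A t : 0 < e -> e <= 1 -> 0 < h -> h <= 1 ->
  (forall j, intw (fun x => flux k (u t) x ord0 j)) ->
  \sum_j Int (fun x => `|flux k (u t) x ord0 j|) <= A ->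
  \sum_j Int (fun x => test_grad n e h j x * flux k (u t) x ord0 j) <= 5 * A.
Proof.
move=> e0 e1 h0 h1 fi FA.
apply: (@le_trans _ _ (5 * \sum_j Int (fun x => `|flux k (u t) x ord0 j|))); last by rewrite ler_wpM2l.
rewrite mulr_sumr; apply: ler_sum => j _; rewrite -Rint_Z; last exact: rintegrable_abs.
have d5 s : `|test_grad n e h j (pt s)| <= 5.
  by apply: (le_trans (test_grad_le n e h e0 e1 h0 j (pt s))); lra.
apply: Rint_le.
- apply: (rintegrable_bounded_mul _ 5 (fun s => test_grad n e h j (pt s)) (fun s => flux k (u t) (pt s) ord0 j)) => //.
  by apply: measurable_point_comp; exact: continuous_test_grad.
- by apply: rintegrable_Z; exact: rintegrable_abs.
- by move=> s; apply: (le_trans (ler_norm _)); rewrite normrM ler_wpM2r.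
Qed.

Section fixed_bound.
Variables (T' A e : R).
Hypotheses (T'T : T' < T) (A0 : 0 <= A) (e0 : 0 < e) (e1 : e <= 1).
Hypothesis fluxA : forall t, 0 < t <= T' ->
  (forall j, intw (fun x => flux k (u t) x ord0 j)) /\
  \sum_j Int (fun x => `|flux k (u t) x ord0 j|) <= A.

Lemma Int_test_growth h s t : 0 < h -> h <= 1 -> 0 < s -> s <= t -> t <= T' ->
  Int (fun x => test_fun n e h x * u t x) <= Int (fun x => test_fun n e h x * u s x) + 5 * A * (t - s).
Proof.
move=> h0 h1 s0 st tT'.
apply: (Int_test_increment k u0 T u S e h e0 h0) => //; first by have := T'T; have := A0; lra.
move=> r rI; have rT : 0 < r <= T' by lra.
have [fi FA] := fluxA r rT.
exact: test_grad_flux_le.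
Qed.

(** The test function is bounded, so convergence in L^1 is enough to let s tend to 0
in [Int_test_growth]. *)
Lemma Int_test_initial h t : 0 < h -> h <= 1 -> 0 < t -> t <= T' ->
  Int (fun x => test_fun n e h x * u t x) <= Int (fun x => test_fun n e h x * u0 x) + 5 * A * t.
Proof.
move=> h0 h1 t0 tT'.
have [B B0 HB] := continuous_compact_support_bounded n _ _ (continuous_test n e h) (test_support n e h h0).
have u0i : intw u0 := datum_integrable D.
apply/ler_addgt0Pr => eps eps0.
have B1 : 0 < B + 1 by have := T'T; have := A0; lra.
have near_s : \forall s \near 0^'+, (integralRd (fun x => `|u s x - u0 x|%R) < (eps / (B + 1))%:E)%E.
  apply: (@sol_init_L1 _ _ _ _ _ _ S [set y | (y < (eps / (B + 1))%:E)%E]).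
  by apply: open_ereal_lt'; rewrite lte_fin divr_gt0.
have [s [[us s0] st]] : exists s, ((integralRd (fun x => `|u s x - u0 x|%R) < (eps / (B + 1))%:E)%E /\ 0 < s) /\ s < t.
  near (0 : R)^'+ => s; exists s; split; first split.
  - by near: s.
  - by near: s; exact: nbhs_right_gt.
  - by near: s; exact: nbhs_right_lt.
have sT : 0 < s < T by have := T'T; have := A0; lra.
have [usi _] := sol_integrable s sT.
have G := Int_test_growth h s t h0 h1 s0 (ltW st) tT'.
apply: (le_trans G).
have ti v : intw v -> intw (fun x => test_fun n e h x * v x) by exact: test_mul_integrable.
have dabs : intw (fun x => `|u s x - u0 x|).
  exact: (rintegrable_abs _ _ (rintegrable_B _ _ _ usi u0i)).
have dI : Int (fun x => `|u s x - u0 x|) <= eps / (B + 1).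
  rewrite -lee_fin /Rintegral fineK; first exact: ltW.
  exact: (integrable_fin_num _ dabs).
have tB : Int (fun x => test_fun n e h x * u s x) - Int (fun x => test_fun n e h x * u0 x) <= B * (eps / (B + 1)).
  rewrite -Rint_B; [|exact: ti..].
  apply: (@le_trans _ _ (B * Int (fun x => `|u s x - u0 x|))); last by rewrite ler_wpM2l.
  rewrite -Rint_Z//; apply: Rint_le.
  - by apply: rintegrable_B; exact: ti.
  - exact: rintegrable_Z.
  - move=> y; rewrite -mulrBr; apply: (le_trans (ler_norm _)).
    by rewrite normrM ler_wpM2r.
have Beps : B * (eps / (B + 1)) <= eps.
  by rewrite mulrA ler_pdivrMr//; nra.
have As : 5 * A * (t - s) <= 5 * A * t by rewrite ler_wpM2l// ?mulr_ge0//; lra.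
by have := T'T; have := A0; lra.
Unshelve. all: by end_near. Qed.

Lemma first_moment_integrable :
  intw (fun x => eucl x * u0 x) /\ first_moment u0 = (Int (fun x => eucl x * u0 x))%:E.
Proof.
have u0i : intw u0 := datum_integrable D.
have ei : intw (fun x => eucl x * u0 x).
  apply/integrableP; split.
    apply/measurable_EFinP; apply: measurable_funM; last exact: (rintegrable_measurable _ _ u0i).
    by apply: measurable_point_comp; apply: continuous_compose; [exact: continuous_nsq|move=> x; exact: sqrt_continuous].
  under eq_integral do rewrite gee0_abs ?lee_fin ?mulr_ge0 ?eucl_ge0 ?(datum_ge0 D)//.
  exact: (datum_moment D).
split => //; rewrite /Rintegral fineK//; exact: (integrable_fin_num _ ei).
Qed.

(** In particular the first moment stays finite, although no decay of the solution
is assumed at positive times. *)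
Lemma mom_bound t : 0 < t -> t <= T' ->
  intw (fun x => bracket n e x * u t x) /\
  mom e t <= Int (fun x => eucl x * u0 x) + e * M + 5 * A * t.
Proof.
move=> t0 tT'.
have tT : 0 < t < T by have := T'T; have := A0; lra.
have [ui _] := sol_integrable t tT.
have u0i : intw u0 := datum_integrable D.
have [ei _] := first_moment_integrable.
apply: (bracket_moment_le e (u t) _ 1) => //; first by move=> x; exact: (sol_ge0 S).
move=> h /andP[h0 h1].
apply: (le_trans (Int_test_initial h t h0 h1 t0 tT')); rewrite lerD2r.
rewrite -Rint_Z// -Rint_D//; last exact: rintegrable_Z.
apply: Rint_le.
- exact: test_mul_integrable.
- by apply: rintegrable_D => //; exact: rintegrable_Z.
- move=> y; rewrite -mulrDl ler_wpM2r ?(datum_ge0 D)//.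
  by apply: (le_trans (test_le n e h h0 (pt y))); exact: bracket_le.
Qed.

Lemma mom_growth s t : 0 < s -> s <= t -> t <= T' -> mom e t <= mom e s + 5 * A * (t - s).
Proof.
move=> s0 st tT'.
have tT : 0 < t < T by have := T'T; have := A0; lra.
have sT : 0 < s < T by have := T'T; have := A0; lra.
have [ui _] := sol_integrable t tT.
have [si _] := sol_integrable s sT.
have [bs _] := mom_bound s s0 (le_trans st tT').
have u_ge0 x : 0 <= u t x by exact: (sol_ge0 S).
suff HB h : 0 < h <= 1 -> Int (fun x => test_fun n e h x * u t x) <= mom e s + 5 * A * (t - s).
  by have [] := bracket_moment_le e (u t) _ 1 ltr01 u_ge0 ui HB.
move=> /andP[h0 h1].
apply: (le_trans (Int_test_growth h s t h0 h1 s0 st tT')); rewrite lerD2r.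
apply: Rint_le => //; first exact: test_mul_integrable.
by move=> y; rewrite ler_wpM2r ?(sol_ge0 S)// test_le.
Qed.

End fixed_bound.
End apriori.

(** * Smallness of the mass near the origin *)

Section concentration.
Context {R : realType} {n : nat}.
Local Notation mR := (measurableTypeR R).
Local Notation pt := (@Defs.point R n).
Local Notation intw f := (rintegrable (leb n) (fun t => f (pt t))).
Local Notation Int f := (\int[leb n]_t f (pt t)).
Variables (k : R -> R) (u0 : 'rV[R]_n -> R) (T : R) (u : R -> 'rV[R]_n -> R).
Hypothesis D : initial_datum u0.
Hypothesis S : solution k u0 T u.
Hypothesis n0 : (0 < n)%N.
Local Notation M := (Int u0).

Lemma leb_box_le (rho : R) : 0 < rho -> rho <= 1 / 2 -> (leb n (box n rho) <= (2 * rho)%:E)%E.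
Proof.
move=> r0 r1; rewrite /leb (@lebesgue_tuple_box R n (fun=> `[- rho, rho]%classic)); last first.
  by move=> i; exact: measurable_itv.
have E : (\prod_(i < n) lebesgue_measure (`[(- rho)%R, rho]%classic : set R) = ((2 * rho) ^+ n)%:E)%E.
  rewrite lebesgue_measure_itv /= lte_fin (_ : (- rho < rho) = true); last by lra.
  rewrite -EFinB (_ : rho - - rho = 2 * rho); last by ring.
  elim: (n) => [|m IH]; first by rewrite big_ord0.
  by rewrite big_ord_recr /= IH exprSr EFinM.
apply: (@le_trans _ _ ((2 * rho) ^+ n)%:E); first by rewrite -E.
rewrite lee_fin -(prednK n0) exprS ler_piMr//; first by lra.
by apply: exprn_ile1; lra.
Qed.

Lemma norm_le_of_box (rho : R) (t : n.-tuple mR) : 0 <= rho -> box n rho t -> `|pt t| <= rho.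
Proof.
move=> r0 bt; have [x0|x0] := eqVneq (mx_norm (pt t)) 0; first by rewrite [leLHS]x0.
have [[i j] xi] := mx_norm_neq0 x0.
rewrite [leLHS]xi /= mxE ler_norml.
by have := bt j; rewrite /= in_itv.
Qed.

Lemma eucl_ge_of_notin_box (rho : R) (t : n.-tuple mR) : ~ box n rho t -> rho <= eucl (pt t).
Proof.
move=> nb; rewrite leNgt; apply/negP => er; apply: nb => i.
rewrite /= in_itv /= -ler_norml; apply: le_trans (ltW er).
by have := le_coord_eucl n (pt t) i; rewrite mxE.
Qed.

(** On the box of half-width rho the weight is at most 1 and u is at most U, a bound
on [lo, hi] x [-1, 1]^n; outside, the weight is at most e / rho.  First rho, then e
is chosen small.  The measure of the box is at most 2 rho, as n > 0. *)
Lemma core_mass_small lo hi eps e' : 0 < lo -> hi < T -> 0 < eps -> 0 < e' ->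
  exists e, [/\ 0 < e, e <= 1, e <= e' &
    forall t, lo <= t <= hi -> Int (fun x => e / bracket n e x * u t x) <= eps].
Proof.
move=> lo0 hiT eps0 e'0.
have [U U0 HU] := jointly_continuous_bounded _ _ (sol_cont S) lo hi 1 lo0 hiT.
have M0 : 0 <= M by apply: Rintegral_ge0 => t _; exact: (datum_ge0 D).
pose rho : R := Num.min (1 / 2) (eps / (4 * (U + 1))).
have U1 : 0 < 4 * (U + 1) by lra.
have M1 : 0 < 2 * (M + 1) by lra.
have r0 : 0 < rho by rewrite lt_min divr_gt0//= divr_gt0.
have r12 : rho <= 1 / 2 by rewrite ge_min lexx.
have rU : U * (2 * rho) <= eps / 2.
  have : rho <= eps / (4 * (U + 1)) by rewrite ge_min lexx orbT.
  by rewrite ler_pdivlMr// => H; nra.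
pose e : R := Num.min 1 (Num.min e' (rho * (eps / (2 * (M + 1))))).
have e0 : 0 < e.
  by rewrite !lt_min ltr01 e'0 /= mulr_gt0// divr_gt0.
have eM : e / rho * M <= eps / 2.
  have : e <= rho * (eps / (2 * (M + 1))) by rewrite !ge_min lexx !orbT.
  rewrite mulrC -ler_pdivrMr// ler_pdivlMr// => H.
  have q0 : 0 < e / rho by rewrite divr_gt0.
  by nra.
exists e; split => //; first by rewrite ge_min lexx.
  by rewrite !ge_min lexx orbT.
move=> t tI; have tT : 0 < t < T by lra.
have [ui uM] := sol_integrable k u0 T u D S t tT.
have bi : rintegrable (leb n) (\1_(box n rho) : n.-tuple mR -> R).
  apply/integrableP; split.
    by apply/measurable_EFinP; apply: measurable_indic; exact: measurable_box_sym.
  under eq_integral do rewrite gee0_abs ?lee_fin//.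
  by rewrite integral_indic ?setIT; [exact: leb_box_lty|exact: measurableT|exact: measurable_box_sym].
have b1 x : 0 <= e / bracket n e x <= 1.
  have b0 := bracket_gt0 n e e0 x.
  rewrite divr_ge0 ?(ltW e0) ?(ltW b0)//= ler_pdivrMr// mul1r.
  by rewrite -[leLHS](gtr0_norm e0) -sqrtr_sqr ler_wsqrtr// lerDl nsq_ge0.
apply: (@le_trans _ _ (\int[leb n]_s (U * \1_(box n rho) s + e / rho * u t (pt s)))); last first.
  rewrite Rint_D; [|exact: rintegrable_Z..].
  rewrite !Rint_Z// uM.
  have V : \int[leb n]_s \1_(box n rho) s <= 2 * rho.
    rewrite -lee_fin /Rintegral fineK; last exact: (integrable_fin_num _ bi).
    by rewrite integral_indic ?setIT; [exact: leb_box_le|exact: measurableT|exact: measurable_box_sym].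
  apply: (le_trans (lerD (le_trans (ler_wpM2l U0 V) rU) eM)).
  by rewrite -splitr.
apply: Rint_le.
- apply: (rintegrable_bounded_mul _ 1 (fun s => e / bracket n e (pt s)) (fun s => u t (pt s))) => //.
    apply: (measurable_point_comp n (fun x => e / bracket n e x)); apply: continuous_mul; first exact: continuous_const.
    apply: continuous_inv; last exact: continuous_bracket.
    by move=> x; rewrite gt_eqF// bracket_gt0.
  by move=> s; have /andP[? ?] := b1 (pt s); rewrite ger0_norm.
- by apply: rintegrable_D; exact: rintegrable_Z.
- move=> s; have us := sol_ge0 S (pt s) tT.
  have /andP[q0 q1] := b1 (pt s).
  have er0 : 0 <= e / rho * u t (pt s) by rewrite mulr_ge0// divr_ge0// ltW.
  have [bs|bs] := pselect (box n rho s).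
    rewrite indicE mem_set// mulr1.
    have xs : `|pt s| <= 1.
      by apply: (le_trans (norm_le_of_box rho s (ltW r0) bs)); lra.
    have := HU t (pt s) tI xs; rewrite (ger0_norm us) => uU.
    apply: (@le_trans _ _ U); last by rewrite lerDl.
    by apply: le_trans uU; rewrite ler_piMl.
  rewrite indicE memNset// mulr0 add0r ler_wpM2r// ler_wpM2l ?(ltW e0)//.
  rewrite lef_pV2 ?posrE ?bracket_gt0//.
  by apply: (le_trans (eucl_ge_of_notin_box rho s bs)); exact: bracket_ge_eucl.
Qed.

End concentration.

(** * Finite time of existence *)

Lemma time_arithmetic (R : realType) (q ms lo : R) : 0 < q -> lo <= 1 / 2 ->
  ~ q / 16 * (16 * ms / q + 1 - lo) <= ms.
Proof.
move=> q0 lo2; have -> : q / 16 * (16 * ms / q + 1 - lo) = ms + q * (1 - lo) / 16.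
  by field; rewrite gt_eqF.
have q1 : 0 < q * (1 - lo) by rewrite mulr_gt0//; lra.
by move=> H; lra.
Qed.

(** The main term is at most - 6/16 kap M^2 by the bound on E, the attraction of
strength L costs at most 4/16 kap M^2, and the two cutoff terms 1/32 kap M^2 each. *)
Lemma rate_arithmetic (R : realType) (kap L C gam h M ms m E F A : R) :
  0 <= kap -> 0 <= L -> 0 <= C -> 0 <= gam -> 0 <= h -> 0 <= M ->
  0 <= E <= M / 2 -> m <= 2 * ms -> F <= A -> 16 * L * ms <= kap * M ->
  4 * gam * (M * ms) <= kap * M ^+ 2 / 32 ->
  4 * h * (C * (M * (2 * ms)) + A) <= kap * M ^+ 2 / 32 ->
  - (kap / 2) * (M ^+ 2 - E ^+ 2) + (2 * L + 4 * h * C + 2 * gam) * (M * m) + 4 * h * F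
    <= - (kap * M ^+ 2 / 16).
Proof.
move=> kap0 L0 C0 gam0 h0 M0 /andP[E0 EM] mms FA Lms gs hs.
have E2 : E ^+ 2 <= M ^+ 2 / 4.
  have := ler_pM E0 E0 EM EM; rewrite -!expr2 => H; apply: (le_trans H).
  by rewrite le_eqVlt; apply/orP; left; apply/eqP; field.
have a1 : kap * E ^+ 2 <= kap * (M ^+ 2 / 4) by rewrite ler_wpM2l.
have Mm : M * m <= M * (2 * ms) by rewrite ler_wpM2l.
have a2 : L * (M * m) <= L * (M * (2 * ms)) by rewrite ler_wpM2l.
have a3 : (16 * L * ms) * M <= (kap * M) * M by rewrite ler_wpM2r.
have a4 : gam * (M * m) <= gam * (M * (2 * ms)) by rewrite ler_wpM2l.
have a5 : h * (C * (M * m)) <= h * (C * (M * (2 * ms))) by rewrite ler_wpM2l// ler_wpM2l.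
have a6 : h * F <= h * A by rewrite ler_wpM2l.
by lra.
Qed.

Section blowup.
Context {R : realType} {n : nat}.
Local Notation mR := (measurableTypeR R).
Local Notation pt := (@Defs.point R n).
Local Notation intw f := (rintegrable (leb n) (fun t => f (pt t))).
Local Notation Int f := (\int[leb n]_t f (pt t)).
Variables (k : R -> R) (kap L : R).
Hypotheses (n0 : (0 < n)%N) (kap0 : 0 < kap) (L0 : 0 <= L).
Hypothesis dk : forall r, 0 < r -> derivable k r 1.
Hypothesis k_le : forall r, 0 < r -> derive1 k r <= - kap + L * r.
Hypothesis k_bound : forall gam, 0 < gam ->
  exists2 C, 0 <= C & forall r, 0 < r -> `|derive1 k r| <= C + gam * r.

Section one_solution.
Variables (u0 : 'rV[R]_n -> R) (T : R) (u : R -> 'rV[R]_n -> R).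
Hypothesis D : initial_datum u0.
Hypothesis S : solution k u0 T u.
Local Notation M := (Int u0).
Local Notation mom e t := (Int (fun x => bracket n e x * u t x)).
Variables (ms T' A e lo : R).
Hypotheses (M0 : 0 < M) (ms0 : 0 < ms) (Lms : 16 * L * ms <= kap * M).
Hypotheses (T'T : T' < T) (A0 : 0 <= A) (e0 : 0 < e) (e1 : e <= 1) (lo0 : 0 < lo).
Hypothesis fluxA : forall t, 0 < t <= T' ->
  (forall j, intw (fun x => flux k (u t) x ord0 j)) /\
  \sum_j Int (fun x => `|flux k (u t) x ord0 j|) <= A.
Hypothesis core : forall t, lo <= t <= T' -> Int (fun x => e / bracket n e x * u t x) <= M / 2.

Let c := kap * M ^+ 2 / 16.

(** The step is so short that the moment stays below 2 ms within it; hence the rate of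
[rate_arithmetic] holds at every intermediate time.  The constants gam and then h
are fixed only here, since the bound C on k' depends on gam. *)
Lemma mom_step s t : lo <= s -> s <= t -> t <= T' -> mom e s <= ms ->
  5 * A * (t - s) <= ms -> mom e t <= mom e s - c * (t - s).
Proof.
move=> los st tT' sms step.
have [s0 tT sT] : [/\ 0 < s, t < T & 0 < s < T].
  by have := T'T; have := lo0; split; lra.
have t0T : 0 < t < T by lra.
have [ui _] := sol_integrable k u0 T u D S t t0T.
have [si _] := sol_integrable k u0 T u D S s sT.
have kM : 0 < kap * M ^+ 2 / 32 by rewrite divr_gt0// mulr_gt0// exprn_gt0.
have Mms : 0 < 4 * (M * ms) by rewrite mulr_gt0// mulr_gt0.
have [gam [gam0 gs]] : exists gam, 0 < gam /\ 4 * gam * (M * ms) <= kap * M ^+ 2 / 32.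
  exists (kap * M ^+ 2 / 32 / (4 * (M * ms))); split; first by rewrite divr_gt0.
  rewrite le_eqVlt; apply/orP; left; apply/eqP; field.
  by rewrite !gt_eqF.
have [C C0 HC] := k_bound gam gam0.
have [Q [Q0 QE]] : exists Q, 0 < Q /\ Q = 4 * (C * (M * (2 * ms)) + A) + 1.
  exists (4 * (C * (M * (2 * ms)) + A) + 1); split => //.
  by rewrite ltr_wpDl// mulr_ge0// addr_ge0// mulr_ge0// mulr_ge0 ?mulr_ge0 ?(ltW M0) ?(ltW ms0).
pose h1 := Num.min 1 (kap * M ^+ 2 / 32 / Q).
have h10 : 0 < h1 by rewrite lt_min ltr01 divr_gt0.
have u_ge0 r x : 0 < r < T -> 0 <= u r x by exact: (sol_ge0 S).
suff HB h : 0 < h <= h1 -> Int (fun x => test_fun n e h x * u t x) <= mom e s - c * (t - s).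
  by have [] := bracket_moment_le e (u t) _ h1 h10 (fun x => u_ge0 t x t0T) ui HB.
move=> /andP[h0 hh1].
have hs : 4 * h * (C * (M * (2 * ms)) + A) <= kap * M ^+ 2 / 32.
  have : h <= kap * M ^+ 2 / 32 / Q by apply: (le_trans hh1); rewrite ge_min lexx orbT.
  by rewrite ler_pdivlMr// QE; lra.
have [bs _] := mom_bound k u0 T u D S T' A e T'T A0 e0 e1 fluxA s s0 (le_trans st tT').
have rate r : s <= r <= t -> \sum_j Int (fun x => test_grad n e h j x * flux k (u r) x ord0 j) <= - c.
  move=> /andP[sr rt].
  have rT' := le_trans rt tT'.
  have r0 := lt_le_trans s0 sr.
  have rT : 0 < r < T by rewrite r0 (le_lt_trans rT' T'T).
  have [ri rM] := sol_integrable k u0 T u D S r rT.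
  have [br _] := mom_bound k u0 T u D S T' A e T'T A0 e0 e1 fluxA r r0 rT'.
  have [mi mle] := mom_integrable_eucl k u0 T u D S e r e0 rT br.
  have [fi FA] := fluxA r ltac:(by rewrite r0).
  have := sum_Int_test_grad_flux_le k kap L C gam e h (u r) (ltW kap0) L0 C0 (ltW gam0) e0 e1 h0
    dk k_le HC (sol_continuous k u0 T u S r rT) (fun x => u_ge0 r x rT)
    (fun x => sol_even S x rT) ri mi (fun x j => sol_conv S x j rT) fi.
  rewrite rM => H; apply: (le_trans H).
  apply: (@rate_arithmetic _ _ _ _ _ _ _ ms _ _ _ A) => //; try exact: ltW.
    rewrite core ?andbT; last by rewrite (le_trans los sr).
    by apply: Rintegral_ge0 => y _; rewrite mulr_ge0 ?u_ge0// divr_ge0 ?(ltW e0)// sqrtr_ge0.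
  apply: (le_trans mle).
  apply: (le_trans (mom_growth k u0 T u D S T' A e T'T A0 e0 e1 fluxA s r s0 sr rT')).
  have : 5 * A * (r - s) <= 5 * A * (t - s) by rewrite ler_wpM2l ?mulr_ge0// lerD2r.
  by lra.
apply: (le_trans (Int_test_increment k u0 T u S e h e0 h0 (- c) s t s0 st tT rate)).
rewrite mulNr lerD2r; apply: Rint_le => //; first exact: test_mul_integrable.
by move=> y; rewrite ler_wpM2r ?u_ge0// test_le.
Qed.

Lemma mom_iterate d N : 0 <= d -> 5 * A * d <= ms -> mom e lo <= ms ->
  lo + N%:R * d <= T' -> mom e (lo + N%:R * d) <= ms - c * (N%:R * d).
Proof.
move=> d0 dms lms.
have c0 : 0 <= c by rewrite /c divr_ge0// mulr_ge0 ?(ltW kap0)// exprn_ge0// ltW.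
elim: N => [|N IH] NT'.
  by rewrite mul0r addr0 mulr0 subr0.
have E : lo + N.+1%:R * d = lo + N%:R * d + d by rewrite -natr1 mulrDl mul1r addrA.
have NT : lo + N%:R * d <= T' by move: NT'; rewrite E; lra.
have Nd : 0 <= N%:R * d by rewrite mulr_ge0.
have {}IH := IH NT.
have cN : 0 <= c * (N%:R * d) by rewrite mulr_ge0.
have dE : lo + N.+1%:R * d - (lo + N%:R * d) = d by rewrite E; ring.
have H := mom_step (lo + N%:R * d) (lo + N.+1%:R * d).
rewrite dE in H; apply: (le_trans (H _ _ NT' _ dms)).
- by rewrite lerDl.
- by rewrite E lerDl.
- by apply: (le_trans IH); rewrite gerBl.
- by rewrite -natr1 mulrDl mul1r mulrDr opprD addrA lerD2r.
Qed.

End one_solution.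

(** If T exceeded the bound T', the moment would become negative at time T', starting
from a time lo <= 1/2 at which it is still below ms. *)
Lemma existence_time_le (u0 : 'rV[R]_n -> R) (M ms T : R) (u : R -> 'rV[R]_n -> R) :
  initial_datum u0 -> integralRd u0 = M%:E -> 0 < M -> (first_moment u0 < ms%:E)%E ->
  16 * L * ms <= kap * M -> solution k u0 T u -> T <= 16 * ms / (kap * M ^+ 2) + 1.
Proof.
move=> D IM M0 + Lms S.
have [mi ->] := first_moment_integrable u0 D; rewrite lte_fin.
set m0 := Int (fun x => eucl x * u0 x) => m0ms.
have m00 : 0 <= m0.
  by apply: Rintegral_ge0 => t _; rewrite mulr_ge0 ?eucl_ge0// (datum_ge0 D).
have ms0 : 0 < ms by lra.
have EM : Int u0 = M by rewrite /Rintegral -/(integralRd u0) IM.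
rewrite leNgt; apply/negP; set T' := _ + 1 => T'T.
have [A A0 fluxA] := flux_bound k u0 T u S T' T'T.
pose lo : R := Num.min (1 / 2) ((ms - m0) / (2 * (5 * A + 1))).
have A1 : 0 < 2 * (5 * A + 1) by lra.
have lo0 : 0 < lo by rewrite lt_min !divr_gt0//; lra.
have lo2 : lo <= 1 / 2 by rewrite ge_min lexx.
have loA : 5 * A * lo <= (ms - m0) / 2.
  have : lo <= (ms - m0) / (2 * (5 * A + 1)) by rewrite ge_min lexx orbT.
  by rewrite ler_pdivlMr// => H; lra.
have kM : 0 < kap * M ^+ 2 by rewrite mulr_gt0// exprn_gt0.
have T'1 : 1 <= T' by rewrite /T' lerDr divr_ge0 ?(ltW kM)//; lra.
have [e [e0 e1 ee core]] := core_mass_small k u0 T u D S n0 lo T' (M / 2) ((ms - m0) / (2 * M))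
  lo0 T'T ltac:(by rewrite divr_gt0) ltac:(by rewrite divr_gt0 ?mulr_gt0//; lra).
have eM : e * M <= (ms - m0) / 2.
  have : e * M <= (ms - m0) / (2 * M) * M by rewrite ler_pM2r.
  by rewrite invfM mulrA mulfVK// gt_eqF.
have [_ mlo] := mom_bound k u0 T u D S T' A e T'T A0 e0 e1 fluxA lo lo0 ltac:(lra).
rewrite -/m0 EM in mlo.
have lms : Int (fun x => bracket n e x * u lo x) <= ms by lra.
pose N := (Num.bound (5 * A * (T' - lo) / ms)).+1.
pose d := (T' - lo) / N%:R.
have N0 : 0 < N%:R :> R by rewrite ltr0n.
have d0 : 0 <= d by rewrite divr_ge0 ?(ltW N0)//; lra.
have NdE : lo + N%:R * d = T' by rewrite /d mulrC mulfVK ?gt_eqF// addrC subrK.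
have dms : 5 * A * d <= ms.
  rewrite /d mulrA ler_pdivrMr// [leRHS]mulrC -ler_pdivrMr//.
  apply: (le_trans (ler_norm _)); apply: ltW; apply: (lt_le_trans (unstable.ltr_norm_bound _)).
  by rewrite ler_nat leqnSn.
have Lms' : 16 * L * ms <= kap * Int u0 by rewrite EM.
have M0' : 0 < Int u0 by rewrite EM.
have core' t : lo <= t <= T' -> Int (fun x => e / bracket n e x * u t x) <= Int u0 / 2.
  by rewrite EM; exact: core.
have := mom_iterate u0 T u D S ms T' A e lo M0' ms0 Lms' T'T A0 e0 e1 lo0 fluxA core' d N d0 dms lms.
rewrite NdE lexx => /(_ isT); rewrite EM => H.
have mT0 : 0 <= Int (fun x => bracket n e x * u T' x).
  apply: Rintegral_ge0 => t _; rewrite mulr_ge0 ?sqrtr_ge0// (sol_ge0 S)//.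
  by rewrite T'T andbT; lra.
have Nd : N%:R * d = T' - lo by rewrite -NdE addrAC subrr add0r.
apply: (time_arithmetic _ _ ms lo kM lo2).
rewrite -/T' -Nd -subr_ge0.
exact: le_trans mT0 H.
Qed.

End blowup.

(** * The conditions on the kernel *)

Section kernel_conditions.
Context {R : realType}.
Implicit Types (k : R -> R).

(** Below a the power is monotone; above a, r^d = r^(d-1) r with a nonincreasing first
factor.  Large a gives sublinear growth, small a a small constant term. *)
Lemma powR_le_affine (a d r : R) : 0 < a -> 0 <= d <= 1 -> 0 < r ->
  r `^ d <= a `^ d + a `^ (d - 1) * r.
Proof.
move=> a0 /andP[d0 d1] r0.
have [ra|ar] := leP r a.
  apply: (@le_trans _ _ (a `^ d)).
    by apply: ge0_ler_powR => //; rewrite nnegrE ltW.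
  by rewrite lerDl mulr_ge0 ?powR_ge0// ltW.
have E : r `^ d = r `^ (d - 1) * r.
  rewrite -[X in _ * X]powRr1 ?(ltW r0)// -powRD ?subrK//.
  by apply/implyP => _; rewrite gt_eqF.
rewrite E; apply: (@le_trans _ _ (a `^ (d - 1) * r)); last by rewrite lerDr powR_ge0.
rewrite ler_wpM2r ?(ltW r0)// -(opprB 1 d) !powRN lef_pV2 ?posrE ?powR_gt0//.
by apply: ge0_ler_powR; rewrite ?subr_ge0// ?nnegrE ?ltW.
Qed.

Lemma condH2_derivable k K0 K1 K2 d : condH2 k K0 K1 K2 d ->
  forall r, 0 < r -> derivable k r 1.
Proof. by move=> [_ _ _ _ [k1 [k2 H]]] r /H[[]]. Qed.

Lemma condH2_derive_le k K0 K1 K2 d : condH2 k K0 K1 K2 d ->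
  forall r, 0 < r -> derive1 k r <= - K1 + K2 * r `^ d.
Proof. by move=> [_ _ _ _ [k1 [k2 H]]] r /H[_ [-> _ ? ?]]; rewrite lerD// lerN2. Qed.

Lemma condH2_sublinear k K0 K1 K2 d : condH2 k K0 K1 K2 d ->
  forall gam, 0 < gam -> exists2 C, 0 <= C & forall r, 0 < r -> `|derive1 k r| <= C + gam * r.
Proof.
move=> [K00 _ _ /andP[d0 d1] [k1 [k2 H]]] gam gam0.
pose a := (gam / K0) `^ (d - 1)^-1.
have a0 : 0 < a by rewrite powR_gt0// divr_gt0.
have aE : K0 * a `^ (d - 1) = gam.
  rewrite /a -powRrM mulVf ?subr_eq0 ?lt_eqF// powRr1 ?ltW ?divr_gt0//.
  by rewrite mulrC divfK// gt_eqF.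
exists (K0 * (1 + a `^ d)); first by rewrite mulr_ge0 ?ltW// addr_gt0// powR_gt0.
move=> r r0; have [_ [_ kr _ _]] := H r r0.
apply: (le_trans kr); rewrite -aE -mulrA -mulrDr ler_wpM2l ?(ltW K00)// -addrA lerD2l.
by apply: powR_le_affine; rewrite ?d0 ?ltW.
Qed.

Lemma condH1_sublinear k : condH1 k ->
  forall gam, 0 < gam -> exists2 C, 0 <= C & forall r, 0 < r -> `|derive1 k r| <= C + gam * r.
Proof.
move=> [_ [K0 K00 H] _] gam gam0; exists K0; first exact: ltW.
move=> r r0; have /andP[k1 k2] := H r r0.
rewrite ler0_norm//; have : 0 <= gam * r by rewrite mulr_ge0 ?ltW.
by lra.
Qed.

(** Up to r0 the derivative is below its supremum - kap; beyond r0 the right-hand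
side is nonnegative. *)
Lemma condH1_derive_le k r0 : condH1 k -> 0 < r0 ->
  exists2 kap, 0 < kap & forall r, 0 < r -> derive1 k r <= - kap + kap / r0 * r.
Proof.
move=> [_ [K0 K00 H] Hs] r00; have := Hs r0 r00.
set s := sup _ => s0; exists (- s) => // r r0'.
have [rr|rr] := ltP r r0.
  have : derive1 k r <= s.
    apply: ub_le_sup.
      by exists 0 => _ [x /= + <-]; rewrite in_itv /= => /andP[x0 _]; have /andP[] := H x x0.
    by exists r => //=; rewrite in_itv /= r0'.
  have : 0 <= - s / r0 * r by rewrite mulr_ge0 ?divr_ge0 ?ltW.
  by lra.
have /andP[_ k0] := H r r0'; apply: (le_trans k0).
have : - s <= - s / r0 * r.
  by rewrite -mulrA ler_peMr ?(ltW s0)// mulrC ler_pdivlMr// mul1r.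
by lra.
Qed.

End kernel_conditions.

(** * The initial datum *)

Section data.
Context {R : realType} {n : nat}.
Local Notation pt := (@Defs.point R n).

Lemma datum_mass (u0 : 'rV[R]_n -> R) : initial_datum u0 ->
  exists2 M, 0 < M & integralRd u0 = M%:E.
Proof.
move=> D.
have u0i : (leb n).-integrable setT (fun t => (u0 (pt t))%:E) := datum_integrable D.
have fin : (\int[leb n]_t (u0 (pt t))%:E)%E \is a fin_num by exact: integrable_fin_num.
exists (fine (\int[leb n]_t (u0 (pt t))%:E)%E); last by rewrite fineK.
have ge0 : (0 <= \int[leb n]_t (u0 (pt t))%:E)%E.
  by apply: integral_ge0 => t _; rewrite lee_fin (datum_ge0 D).
rewrite lt_neqAle fine_ge0// andbT eq_sym; apply/negP => /eqP I0.
apply: (datum_neq0 D).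
have Z : (\int[leb n]_t `|(u0 (pt t))%:E| = 0)%E.
  under eq_integral do rewrite gee0_abs ?lee_fin ?(datum_ge0 D)//.
  by rewrite -(fineK fin) I0.
have /ae_eq_integral_abs : measurable_fun setT (fun t => (u0 (pt t))%:E) := measurable_int _ u0i.
move=> /(_ (leb n) measurableT) [/(_ Z) H _].
apply: filterS H => t /(_ I) [].
by move=> ->.
Qed.

Lemma datum_moment_real (u0 : 'rV[R]_n -> R) : initial_datum u0 ->
  exists2 m, 0 <= m & first_moment u0 = m%:E.
Proof.
move=> D; have [_ E] := first_moment_integrable u0 D.
exists (\int[leb n]_t (eucl (pt t) * u0 (pt t))) => //.
by apply: Rintegral_ge0 => t _; rewrite mulr_ge0 ?eucl_ge0// (datum_ge0 D).
Qed.

End data.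

(** * Blow-up *)

Theorem theorem2p1 (R : realType) (d : nat) (hd : (0 < d)%N)
    (k : R -> R) (hk : locally_lipschitz k) :
  (condH1 k \/ (exists K0 K1 delta : R, condH2 k K0 K1 0 delta) ->
    forall u0 : 'rV[R]_d -> R, initial_datum u0 -> ceases_to_exist k u0)
  /\
  (forall K0 K1 K2 delta : R, condH2 k K0 K1 K2 delta ->
    (delta = 0 -> K2 < K1) ->
    forall M : R, 0 < M ->
    exists2 eps : R, 0 < eps &
      forall u0 : 'rV[R]_d -> R, initial_datum u0 ->
        integralRd u0 = M%:E -> (first_moment u0 < eps%:E)%E ->
        ceases_to_exist k u0).
Proof.
split.
- move=> H u0 D.
  have [M M0 IM] := datum_mass u0 D.
  have [m m0 Im] := datum_moment_real u0 D.
  have mlt : (first_moment u0 < (m + 1)%:E)%E by rewrite Im lte_fin ltrDl.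
  have m1 : 0 < m + 1 by lra.
  case: H => [H1|[K0 [K1 [delta H2]]]].
    (* r0 is such that 16 L (m + 1) = kap M for L = kap / r0 *)
    have r0 : 0 < 16 * (m + 1) / M by rewrite divr_gt0// mulr_gt0.
    have [kap kap0 Hk] := condH1_derive_le k _ H1 r0.
    have [dk _ _] := H1.
    exists (16 * (m + 1) / (kap * M ^+ 2) + 1) => T u S.
    apply: (existence_time_le k kap (kap / (16 * (m + 1) / M)) hd kap0 _ dk Hk (condH1_sublinear k H1) u0 M (m + 1) T u) => //.
      by rewrite divr_ge0 ?ltW.
    rewrite le_eqVlt; apply/orP; left; apply/eqP; field.
    by rewrite !gt_eqF.
  have K10 : 0 < K1 by case: H2.
  exists (16 * (m + 1) / (K1 * M ^+ 2) + 1) => T u S.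
  apply: (existence_time_le k K1 0 hd K10 (lexx 0) (condH2_derivable _ _ _ _ _ H2) _ (condH2_sublinear _ _ _ _ _ H2) u0 M (m + 1) T u) => //.
    by move=> r r0; have := condH2_derive_le _ _ _ _ _ H2 r r0; rewrite !mul0r.
  by rewrite mulr0 mul0r mulr_ge0 ?ltW.
- move=> K0 K1 K2 delta H2 dK M M0.
  have [_ K10 K20 /andP[d0 d1] _] := H2.
  suff [kap [L [kap0 L0 Hk]]] : exists kap L, [/\ 0 < kap, 0 <= L &
      forall r, 0 < r -> derive1 k r <= - kap + L * r].
    have L1 : 0 < 16 * (L + 1) by lra.
    have kM : 0 < kap * M by rewrite mulr_gt0.
    exists (kap * M / (16 * (L + 1))); first by rewrite divr_gt0.
    move=> u0 D IM mlt.
    exists (16 * (kap * M / (16 * (L + 1))) / (kap * M ^+ 2) + 1) => T u S.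
    apply: (existence_time_le k kap L hd kap0 L0 (condH2_derivable _ _ _ _ _ H2) Hk (condH2_sublinear _ _ _ _ _ H2) u0 M _ T u) => //.
    by rewrite mulrA ler_pdivrMr// mulrC ler_wpM2l ?(ltW kM)//; lra.
  have [dz|dnz] := eqVneq delta 0.
    exists (K1 - K2), 0; split => //; first by rewrite subr_gt0 dK.
    move=> r r0; have := condH2_derive_le _ _ _ _ _ H2 r r0.
    by rewrite dz powRr0; lra.
  have q0 : 0 < K1 / (2 * (K2 + 1)) by rewrite divr_gt0//; lra.
  (* a is such that K2 a^delta <= K1 / 2 *)
  pose a := (K1 / (2 * (K2 + 1))) `^ delta^-1.
  have a0 : 0 < a by rewrite powR_gt0.
  have aE : a `^ delta = K1 / (2 * (K2 + 1)).
    by rewrite /a -powRrM mulVf// powRr1// ltW.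
  exists (K1 / 2), (K2 * a `^ (delta - 1)); split.
  + by rewrite divr_gt0.
  + by rewrite mulr_ge0// powR_ge0.
  + move=> r r0; apply: (le_trans (condH2_derive_le _ _ _ _ _ H2 r r0)).
    have := powR_le_affine a delta r a0 ltac:(by rewrite d0 ltW) r0.
    rewrite aE => /(ler_wpM2l K20).
    have : K2 * (K1 / (2 * (K2 + 1))) <= K1 / 2.
      have K21 : 0 < 2 * (K2 + 1) by lra.
      by rewrite mulrA ler_pdivrMr//; lra.
    by rewrite mulrDr; lra.
Qed.
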